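(* Let $n\geq 2$, $\delta\in(0,1)$, and let $\Omega\subset\mathbb{R}^n$ be a domain of finite Lebesgue measure that satisfies the separation property with a distinguished point $x_0\in\Omega$. Let $1\leq p<\frac{n}{\delta}$. Suppose that, for some $q>p$ (with $q<\infty$), $\Omega$ is a fractional $(q,p)$-Sobolev-Poincaré domain with $\tau=1$, i.e. there is a constant $C_1$ such that for every $u\in C(\Omega)$ $$\int_\Omega|u(x)-u_\Omega|^q\,dx\leq C_1\Big(\int_\Omega\int_{\Omega\cap B(x,d(x,\partial\Omega))}\frac{|u(x)-u(y)|^p}{|x-y|^{n+p\delta}}\,dy\,dx\Big)^{q/p}.$$ Then there is a constant $C$ such that for each $x\in\Omega$ there is a curve $\gamma:[0,1]\to\Omega$ with $\gamma(0)=x$, $\gamma(1)=x_0$ and $$\operatorname{diam}\gamma([0,t])\leq C\,\varphi\big(d(\gamma(t),\partial\Omega)\big)\quad\text{for all }t\in[0,1],$$ where $\varphi(r)=r^{\frac{(n-p\delta)q}{p\delta}\left(\frac{1}{p}-\frac{1}{q}\right)}$.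
   Context: A domain $\Omega\subset\mathbb{R}^n$ with a distinguished point $x_0$ has the separation property if there exists a constant $C_0$ such that for every $x\in\Omega$ there exists a curve $\gamma:[0,1]\to\Omega$ with $\gamma(0)=x$, $\gamma(1)=x_0$, and such that for each $t$ either $$\gamma([0,t])\subset B_t:=B(\gamma(t),C_0\,d(\gamma(t),\partial\Omega)),$$ or each $y\in\gamma([0,t])\setminus B_t$ and $x_0$ belong to different components of $\Omega\setminus\partial B_t$. Curves are continuous; $d(\cdot,\partial\Omega)$ is the Euclidean distance to the boundary; $B(x,r)$ is the Euclidean ball with centre $x$ and radius $r$; $C(\Omega)$ is the set of continuous real-valued functions on $\Omega$; $u_\Omega=\frac{1}{|\Omega|}\int_\Omega u(x)\,dx$. *)

(* Defs.v *)
From HB Require Import structures.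
From mathcomp Require Import all_boot all_order all_algebra.
From mathcomp Require Import all_classical all_reals all_analysis.

Set Implicit Arguments.
Unset Strict Implicit.
Unset Printing Implicit Defensive.

Import Order.TTheory GRing.Theory Num.Theory.
Import numFieldNormedType.Exports.

Local Open Scope classical_set_scope.
Local Open Scope ring_scope.

(* The sigma-algebra on R^n is the one generated by the coordinates, as for
   [n.-tuple R]. *)

Definition measure_rV_display : measure_display -> measure_display.
Proof. exact. Qed.

Section measurable_rV.
Context {R : realType} (n : nat).

Let coord : 'I_n -> 'rV[R]_n -> R := fun i v => v ord0 i.

Let rV_set0 : g_sigma_preimage coord set0.
Proof. exact: sigma_algebra0. Qed.

Let rV_setC A : g_sigma_preimage coord A -> g_sigma_preimage coord (~` A).
Proof. exact: sigma_algebraC. Qed.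

Let rV_bigcup (F : _^nat) : (forall i, g_sigma_preimage coord (F i)) ->
  g_sigma_preimage coord (\bigcup_i (F i)).
Proof. exact: sigma_algebra_bigcup. Qed.

HB.instance Definition _ :=
  @isMeasurable.Build (measure_rV_display default_measure_display)
    'rV[R]_n (g_sigma_preimage coord) rV_set0 rV_setC rV_bigcup.

Lemma measurable_rV_coord (i : 'I_n) :
  measurable_fun [set: 'rV[R]_n] (fun v : 'rV[R]_n => v ord0 i).
Proof.
move=> _ Y mY; rewrite setTI; apply: sub_sigma_algebra => /=.
rewrite -bigcup_seq/=; exists i => /=; first by rewrite mem_index_enum.
by exists Y => //; rewrite setTI.
Qed.

Lemma measurable_fun_rV d (T : measurableType d) (f : T -> 'rV[R]_n) :
  (forall i, measurable_fun [set: T] (fun t => f t ord0 i)) ->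
  measurable_fun [set: T] f.
Proof.
move=> mf; apply: (@measurability _ _ _ _ _ _
  (\big[setU/set0]_(i < n) preimage_set_system setT (coord i) measurable)).
  by [].
move=> _ [B + <-]; rewrite -bigcup_seq => -[i _ [A mA <-]].
by rewrite setTI => //; have := mf i measurableT _ mA; rewrite !setTI.
Qed.

End measurable_rV.

Section lebesgue_rV.
Context {R : realType}.

Definition cons_rV n (xv : R * 'rV[R]_n) : 'rV[R]_n.+1 :=
  row_mx (xv.1)%:M xv.2.

Definition uncons_rV n (v : 'rV[R]_n.+1) : R * 'rV[R]_n :=
  (v ord0 ord0, @rsubmx R 1 1 n v).

Lemma cons_rVE0 n (xv : R * 'rV[R]_n) (j : 'I_1) :
  cons_rV xv ord0 (lshift n j) = xv.1.
Proof. by rewrite /cons_rV (@row_mxEl R 1 1 n) mxE (ord1 j). Qed.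

Lemma cons_rVES n (xv : R * 'rV[R]_n) (j : 'I_n) :
  cons_rV xv ord0 (rshift 1 j) = xv.2 ord0 j.
Proof. by rewrite /cons_rV (@row_mxEr R 1 1 n). Qed.

Lemma cons_rVK n : cancel (@cons_rV n) (@uncons_rV n).
Proof.
move=> [x v]; rewrite /uncons_rV /cons_rV (@row_mxKr R 1 1 n); congr pair.
rewrite -[RHS](cons_rVE0 (x, v) ord0); congr (cons_rV _ _ _).
exact/val_inj.
Qed.

Lemma measurable_cons_rV n : measurable_fun setT (@cons_rV n).
Proof.
apply: measurable_fun_rV => i; case: (@splitP 1 n i) => j ij.
  have -> : i = lshift n j by exact/val_inj.
  rewrite (_ : (fun _ => _) = fst)//; apply/funext => xv.
  exact: cons_rVE0.
have -> : i = rshift 1 j by exact/val_inj.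
rewrite (_ : (fun _ => _) = (fun v : 'rV[R]_n => v ord0 j) \o snd).
  by apply: measurableT_comp => //; exact: measurable_rV_coord.
by apply/funext => xv; exact: cons_rVES.
Qed.

Lemma measurable_uncons_rV n : measurable_fun setT (@uncons_rV n).
Proof.
apply/measurable_fun_pairP; split; first exact: measurable_rV_coord.
apply: measurable_fun_rV => i /=.
rewrite (_ : (fun _ => _) = (fun v : 'rV[R]_n.+1 => v ord0 (rshift 1 i))).
  exact: measurable_rV_coord.
by apply/funext => v; rewrite /uncons_rV/= mxE.
Qed.

Section step.
Variables (n : nat) (mu : {sigma_finite_measure set 'rV[R]_n -> \bar R}).

Definition lebesgue_rV_step : set 'rV[R]_n.+1 -> \bar R :=
  pushforward (@lebesgue_measure R \x mu)%E (@cons_rV n).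

Let step0 : lebesgue_rV_step set0 = 0%E.
Proof. by rewrite /lebesgue_rV_step /pushforward preimage_set0 measure0. Qed.

Let step_ge0 A : (0 <= lebesgue_rV_step A)%E.
Proof. exact: (@measure_ge0 _ _ _ (@lebesgue_measure R \x mu)%E). Qed.

Let step_sigma_additive : semi_sigma_additive lebesgue_rV_step.
Proof.
move=> F mF tF mUF; rewrite /lebesgue_rV_step /pushforward preimage_bigcup.
have mcons A : measurable A -> measurable (@cons_rV n @^-1` A).
  by move=> mA; rewrite -[X in measurable X]setTI; exact: measurable_cons_rV.
apply: measure_semi_sigma_additive.
- by move=> i; exact: mcons.
- apply/trivIsetP => /= i j _ _ ij; rewrite -preimage_setI.
  by move/trivIsetP : tF => /(_ _ _ _ _ ij) ->//; rewrite preimage_set0.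
- by rewrite -preimage_bigcup; exact: mcons.
Qed.

HB.instance Definition _ := isMeasure.Build _ _ _ lebesgue_rV_step
  step0 step_ge0 step_sigma_additive.

Let step_sigma_finite : sigma_finite setT lebesgue_rV_step.
Proof.
have /sigma_finiteP[F [TF ndF Foo]] := sigma_finiteT (@lebesgue_measure R).
have /sigma_finiteP[G [TG ndG Goo]] := sigma_finiteT mu.
exists (fun i => @uncons_rV n @^-1` (F i `*` G i)).
  apply/seteqP; split=> // v _.
  have [i _ Fi] : (\bigcup_i F i) (uncons_rV v).1 by rewrite -TF.
  have [j _ Gj] : (\bigcup_i G i) (uncons_rV v).2 by rewrite -TG.
  exists (maxn i j) => //; split.
    by move: Fi; exact/subsetPset/ndF/leq_maxl.
  by move: Gj; exact/subsetPset/ndG/leq_maxr.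
move=> i; have [mFi Fioo] := Foo i; have [mGi Gioo] := Goo i; split.
  rewrite -[X in measurable X]setTI; apply: measurable_uncons_rV => //.
  exact: measurableX.
rewrite /lebesgue_rV_step /pushforward -comp_preimage.
rewrite (_ : _ \o _ = id); last by apply/funext => xv; exact: cons_rVK.
by rewrite preimage_id product_measure1E// lte_mul_pinfty// ge0_fin_numE.
Qed.

HB.instance Definition _ := Measure_isSigmaFinite.Build _ _ _ lebesgue_rV_step
  step_sigma_finite.

End step.

(* Lebesgue measure on R^n, restricted to the Borel sets, by iterating the
   product with the one-dimensional measure; R^0 carries the unit mass. *)
Fixpoint lebesgue_rV n : {sigma_finite_measure set 'rV[R]_n -> \bar R} :=
  if n isn't m.+1 then \d_(0 : 'rV[R]_0)
  else lebesgue_rV_step (lebesgue_rV m).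

End lebesgue_rV.

Section euclidean.
Context {R : realType} {n : nat}.
Implicit Types (x y : 'rV[R]_n) (A Omega : set 'rV[R]_n).

(* The norm that the library puts on ['rV[R]_n] is the sup norm: its topology is
   the right one, but the metric notions have to be Euclidean. *)
Definition enorm x : R := Num.sqrt (\sum_(i < n) x ord0 i ^+ 2).

Definition eball x (r : R) : set 'rV[R]_n := [set y | enorm (y - x) < r].

Definition ediam A : \bar R :=
  ereal_sup [set (enorm (xy.1 - xy.2))%:E | xy in A `*` A].

Definition boundary A : set 'rV[R]_n := closure A `\` A°.

(* Junk value 0 when the boundary is empty, i.e. for the empty set and R^n. *)
Definition bdist Omega x : R := inf [set enorm (x - y) | y in boundary Omega].

Definition domain Omega := [/\ open Omega, connected Omega & Omega !=set0].

Definition curve_from_to Omega x y (gamma : R -> 'rV[R]_n) :=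
  [/\ {within `[0, 1], continuous gamma},
      forall t : R, t \in `[0, 1] -> Omega (gamma t),
      gamma 0 = x & gamma 1 = y].

(* "y and x0 belong to different components of Omega \ dB_t" means that no
   component contains both of them, so points of dB_t itself are no obstruction:
   a curve that leaves the open ball B_t around gamma t always meets dB_t.
   With this reading it does not matter whether B_t is open or closed. *)
Definition separation_property Omega x0 :=
  exists2 C0 : R, 0 < C0 &
  forall x, Omega x -> exists2 gamma, curve_from_to Omega x x0 gamma &
  forall t : R, t \in `[0, 1] ->
    let Bt := eball (gamma t) (C0 * bdist Omega (gamma t)) in
    gamma @` `[0, t] `<=` Bt \/
    forall y, (gamma @` `[0, t] `\` Bt) y ->
      ~ connected_component (Omega `\` boundary Bt) y x0.

Local Notation leb := (lebesgue_rV n).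

Definition mean Omega (u : 'rV[R]_n -> R) : R :=
  (fine (leb Omega))^-1 * \int[leb]_(x in Omega) u x.

Definition fractional_energy (delta p tau : R) Omega (u : 'rV[R]_n -> R)
    : \bar R :=
  (\int[leb]_(x in Omega)
     \int[leb]_(y in Omega `&` eball x (tau * bdist Omega x))
       ((`|u x - u y| `^ p) / (enorm (x - y) `^ (n%:R + p * delta)))%:E)%E.

(* Continuous functions that are not integrable have no mean value; they are
   left out, and including them would only strengthen the condition. *)
Definition fractional_sobolev_poincare (delta q p tau : R) Omega :=
  exists2 C1 : R, 0 < C1 &
  forall u : 'rV[R]_n -> R, {within Omega, continuous u} ->
    leb.-integrable Omega (EFin \o u) ->
    (\int[leb]_(x in Omega) (`|u x - mean Omega u| `^ q)%:E
      <= C1%:E * fractional_energy delta p tau Omega u `^ (q / p))%E.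

End euclidean.

(* Main.v *)
Require Import Defs.
From mathcomp Require Import all_boot all_order all_algebra.
From mathcomp Require Import all_classical all_reals all_analysis.
From mathcomp Require Import measurable_realfun.
From mathcomp Require Import ring lra.
Import Order.TTheory GRing.Theory Num.Theory.
Import numFieldNormedType.Exports.
Local Open Scope classical_set_scope.
Local Open Scope ring_scope.

(* Write d for the distance to the boundary, y = gamma t, B = B(y, C0 d(y)), and
   let T be the component of Omega \ dB of a point of gamma([0, t]) outside B.
   Test the inequality with u = f(|x - y|) on T and u = 0 elsewhere, f a linear
   ramp of width rho. Since the energy only sees pairs (x, x') with
   |x - x'| < d(x), whose segment lies in Omega, u is 1/rho-Lipschitz on them, and
   pairs with x in A or x' in A contribute at most K rho^(- p delta) |A|.
   - For the ramp between C0 d(y) and (1 + 2 C0) d(y) one can take for A the ball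
     of radius (1 + 2 C0) d(y): a pair that T separates cannot lie outside of it.
     This gives |T \ A| <= C d(y)^((n - p delta) q / p).
   - For the ramp between r < r' further out, A = T \ B(y, r) and
     |T \ B(y, r')| <= C ((r' - r)^(- p delta) |T \ B(y, r)|)^(q / p). As q > p,
     Stampacchia's iteration makes T empty beyond a radius of the required size.
   Finally, bumps shrinking to a point show that phi has an exponent at most 1, so
   that d <= C phi(d). *)

(** * Euclidean norm and balls, segments, connected components *)

Section enorm_theory.
Context {R : realType} {n : nat}.
Implicit Types (x y z : 'rV[R]_n) (r : R) (A : set 'rV[R]_n).

Lemma enorm_ge0 x : 0 <= enorm x.
Proof. exact: sqrtr_ge0. Qed.

Lemma enorm_sqr x : enorm x ^+ 2 = \sum_(i < n) x ord0 i ^+ 2.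
Proof. by rewrite sqr_sqrtr// sumr_ge0// => i _; rewrite sqr_ge0. Qed.

Lemma enormN x : enorm (- x) = enorm x.
Proof. by congr Num.sqrt; apply: eq_bigr => i _; rewrite mxE sqrrN. Qed.

Lemma enorm0 : enorm (0 : 'rV[R]_n) = 0.
Proof. by rewrite /enorm big1 ?sqrtr0// => i _; rewrite mxE expr0n. Qed.

Lemma enormB x y : enorm (x - y) = enorm (y - x).
Proof. by rewrite -enormN opprB. Qed.

Lemma enormZ r x : enorm (r *: x) = `|r| * enorm x.
Proof.
rewrite /enorm (eq_bigr (fun i => r ^+ 2 * x ord0 i ^+ 2)); last first.
  by move=> i _; rewrite mxE exprMn.
by rewrite -mulr_sumr sqrtrM ?sqr_ge0// sqrtr_sqr.
Qed.

Lemma coord_le_enorm x i : `|x ord0 i| <= enorm x.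
Proof.
rewrite -sqrtr_sqr; apply: ler_wsqrtr.
rewrite (bigD1 i)//= lerDl sumr_ge0// => j _; exact: sqr_ge0.
Qed.

Lemma enorm_le_sum x : enorm x <= \sum_(i < n) `|x ord0 i|.
Proof.
have s0 : 0 <= \sum_(i < n) `|x ord0 i| by apply: sumr_ge0.
rewrite -(ler_pXn2r (n := 2))// ?nnegrE ?enorm_ge0//.
rewrite enorm_sqr expr2 mulr_suml; apply: ler_sum => i _.
rewrite -real_normK ?num_real// expr2 ler_wpM2l//.
by rewrite (bigD1 i)//= lerDl sumr_ge0.
Qed.

Lemma norm_le_enorm x : `|x| <= enorm x.
Proof.
rewrite /Num.norm/= mx_normrE; apply: bigmax_le; first exact: enorm_ge0.
by move=> [i j] _ /=; rewrite ord1; exact: coord_le_enorm.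
Qed.

Lemma enorm_le_norm x : enorm x <= n%:R * `|x|.
Proof.
apply: le_trans (enorm_le_sum x) _.
rewrite -[n in n%:R]card_ord -sum1_card natr_sum mulr_suml ler_sum// => i _.
rewrite mul1r /Num.norm/= mx_normrE.
exact: (le_bigmax _ (fun i : 'I_1 * 'I_n => `|x i.1 i.2|) (ord0, i)).
Qed.

Lemma enorm_eq0 x : enorm x = 0 -> x = 0.
Proof.
move=> x0; apply/normr0_eq0/eqP; rewrite eq_le normr_ge0 andbT -x0.
exact: norm_le_enorm.
Qed.

(** Cauchy-Schwarz, from the squares (b x_i - a y_i)^2 >= 0 with a and b the two norms, once
    vanishing norms are set aside. *)
Lemma enorm_dot x y :
  \sum_(i < n) x ord0 i * y ord0 i <= enorm x * enorm y.
Proof.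
have [x0|x0] := eqVneq (enorm x) 0.
  rewrite x0 mul0r big1// => i _.
  by rewrite (enorm_eq0 _ x0) mxE mul0r.
have [y0|y0] := eqVneq (enorm y) 0.
  rewrite y0 mulr0 big1// => i _.
  by rewrite (enorm_eq0 _ y0) mxE mulr0.
set a := enorm x in x0 *; set b := enorm y in y0 *.
have a0 : 0 < a by rewrite lt_neqAle eq_sym x0 enorm_ge0.
have b0 : 0 < b by rewrite lt_neqAle eq_sym y0 enorm_ge0.
suff : (2 * a * b) * \sum_(i < n) x ord0 i * y ord0 i <=
    (2 * a * b) * (a * b) by rewrite ler_pM2l// !mulr_gt0.
have -> : (2 * a * b) * (a * b) =
    b ^+ 2 * (\sum_(i < n) x ord0 i ^+ 2) + a ^+ 2 * (\sum_(i < n) y ord0 i ^+ 2).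
  by rewrite -!enorm_sqr -/a -/b; ring.
rewrite !mulr_sumr -big_split/=; apply: ler_sum => i _.
have := sqr_ge0 (b * x ord0 i - a * y ord0 i); nra.
Qed.

Lemma enormD x y : enorm (x + y) <= enorm x + enorm y.
Proof.
rewrite -(ler_pXn2r (n := 2))// ?nnegrE ?addr_ge0 ?enorm_ge0//.
rewrite sqrrD !enorm_sqr.
rewrite (eq_bigr (fun i => x ord0 i ^+ 2 + y ord0 i ^+ 2 +
   2 * (x ord0 i * y ord0 i))); last by move=> i _; rewrite mxE; ring.
rewrite !big_split/= -mulr_sumr; have := enorm_dot x y; lra.
Qed.

Lemma enormBD z x y : enorm (x - y) <= enorm (x - z) + enorm (z - y).
Proof. by rewrite -[x - y](subrKA z) enormD. Qed.

Lemma continuous_enormB y : continuous (fun x => enorm (x - y)).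
Proof.
move=> x; apply/(@cvgrPdist_lt _ R^o _ _ (nbhs_filter x)) => e e0; apply/nbhs_ballP.
exists (e / n.+1%:R) => /=; first by rewrite divr_gt0 ?ltr0n.
move=> z; rewrite -ball_normE/= ltr_pdivlMr ?ltr0n// => xz.
apply: (@le_lt_trans _ _ (enorm (x - z))).
  rewrite ler_norml; have := enormBD z x y; have := enormBD x z y.
  by rewrite (enormB z x); lra.
apply: le_lt_trans (enorm_le_norm _) _; apply: le_lt_trans xz.
by rewrite mulrC ler_wpM2l// ler_nat.
Qed.

Lemma open_eball x r : open (eball x r).
Proof.
rewrite (_ : eball x r = (fun y => enorm (y - x)) @^-1` [set z | z < r])//.
by apply: open_comp; [move=> ? _; exact: continuous_enormB|exact: open_lt].
Qed.

Lemma closed_enormB_le x r : closed [set y | enorm (y - x) <= r].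
Proof.
rewrite (_ : [set _ | _] = (fun y => enorm (y - x)) @^-1` [set z | z <= r])//.
by apply: closed_comp; [move=> ? _; exact: continuous_enormB|exact: closed_le].
Qed.

Lemma boundary_eball_le x r y :
  boundary (eball x r) y -> enorm (y - x) <= r.
Proof.
move=> [cy _]; suff : [set z | enorm (z - x) <= r] y by [].
rewrite (iffLR (closure_id _) (closed_enormB_le x r)).
by apply: closure_subset cy => z /ltW.
Qed.

Lemma closed_boundary A : closed (boundary A).
Proof.
rewrite /boundary setDE; apply: closedI; first exact: closed_closure.
by rewrite closedC; exact: open_interior.
Qed.

Lemma eballxx x r : 0 < r -> eball x r x.
Proof. by move=> r0; rewrite /eball/= subrr enorm0. Qed.

Definition segment x y := (fun t : R => x + t *: (y - x)) @` `[0, 1].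

Lemma connected_segment x y : connected (segment x y).
Proof.
apply: connected_continuous_connected; first exact: segment_connected.
apply: continuous_subspaceT => t.
apply: cvgD; first exact: cvg_cst.
by apply: cvgZr_tmp; exact: cvg_id.
Qed.

Lemma segment_left x y : segment x y x.
Proof. by exists 0; rewrite ?scale0r ?addr0//= in_itv/= lexx ler01. Qed.

Lemma segment_right x y : segment x y y.
Proof. by exists 1; rewrite ?scale1r ?subrKC//= in_itv/= lexx ler01. Qed.

Lemma segmentC x y : segment x y = segment y x.
Proof.
suff sub (a b : 'rV[R]_n) : segment a b `<=` segment b a.
  by apply/seteqP; split; exact: sub.
move=> _ [t /= t01 <-]; exists (1 - t).
  by move: t01; rewrite /= !in_itv/= => /andP[? ?]; apply/andP; split; lra.
by apply/rowP => i; rewrite !mxE; ring.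
Qed.

Lemma segment_enorm x y z : segment x y z ->
  enorm (x - z) + enorm (z - y) = enorm (x - y).
Proof.
move=> [t /=]; rewrite in_itv/= => /andP[t0 t1] <-.
have -> : x - (x + t *: (y - x)) = t *: (x - y).
  by rewrite opprD addrA subrr sub0r -scalerN opprB.
have -> : x + t *: (y - x) - y = (1 - t) *: (x - y).
  by rewrite scalerBl scale1r -[y - x]opprB scalerN addrAC.
by rewrite !enormZ !ger0_norm ?subr_ge0//; ring.
Qed.

Lemma segment_sub_eball x y r : enorm (x - y) < r ->
  segment x y `<=` eball x r.
Proof.
move=> xyr z /segment_enorm xz; rewrite /eball/= enormB.
by apply: le_lt_trans xyr; rewrite -xz lerDl enorm_ge0.
Qed.

(** If the segment missed the boundary, its part in [A] would be relatively open (cut out by the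
    interior) and relatively closed (cut out by the closure), hence the whole connected segment. *)
Lemma segment_boundary A x y : A x -> ~ A y ->
  exists2 z, segment x y z & boundary A z.
Proof.
move=> Ax Ay; apply: contrapT => noz.
have nb z : segment x y z -> ~ boundary A z.
  by move=> xyz Az; apply: noz; exists z.
suff E : segment x y `&` A = segment x y.
  by apply: Ay; have := segment_right x y; rewrite -E => -[].
apply: (connected_segment x y).
- by exists x; split => //; exact: segment_left.
- exists A°; first exact: open_interior.
  apply/seteqP; split => z [xyz Az]; split => //; last exact: interior_subset.
  apply: contrapT => nAz; apply: (nb z xyz); split => //.
  exact: subset_closure.
- exists (closure A); first exact: closed_closure.
  apply/seteqP; split => z [xyz Az]; split => //; first exact: subset_closure.
  apply: contrapT => nAz; apply: (nb z xyz); split => // /interior_subset.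
  exact: nAz.
Qed.

Lemma open_eballP A x : open A -> A x -> exists2 r, 0 < r & eball x r `<=` A.
Proof.
move=> oA Ax; have /nbhs_ballP[r /= r0 rA] := open_nbhs_nbhs (conj oA Ax).
exists r => // y; rewrite /eball/= => xy; apply: rA.
rewrite -ball_normE/=; apply: le_lt_trans xy; rewrite distrC.
exact: norm_le_enorm.
Qed.

Lemma connected_component_segment A x y z :
  connected_component A x y -> segment y z `<=` A ->
  connected_component A x z.
Proof.
move=> [B [Bx BA cB] By] yzA; exists (B `|` segment y z); last first.
  by right; exact: segment_right.
split; [by left|by move=> w []; [exact: BA|exact: yzA]|].
apply: connectedU => //; last exact: connected_segment.
by exists y; split => //; exact: segment_left.
Qed.

Lemma open_connected_component A x : open A -> open (connected_component A x).
Proof.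
move=> oA; rewrite openE => y Ay.
have [r r0 rA] := open_eballP _ _ oA (connected_component_sub Ay).
suff yA : eball y r `<=` connected_component A x.
  by apply: (interiorS yA); rewrite (iffLR (interior_id _) (open_eball y r)); exact: eballxx.
move=> z yz; apply: connected_component_segment Ay _ => w yzw; apply: rA.
by move: yzw; apply: segment_sub_eball; rewrite enormB.
Qed.

End enorm_theory.

(** The integral of a nonnegative function is a supremum over simple functions below it, so a
    pointwise bound passes to integrals even when measurability is not established, as for the inner
    integrals of the energy. *)
Lemma ge0_le_integral_nomeas d (T : measurableType d) (R : realType)
    (mu : {measure set T -> \bar R}) (D : set T) (f g : T -> \bar R) :
  (forall x, D x -> 0 <= f x)%E -> (forall x, D x -> f x <= g x)%E ->
  (\int[mu]_(x in D) f x <= \int[mu]_(x in D) g x)%E.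
Proof.
move=> f0 fg; rewrite !ge0_integralE//; last first.
  by move=> x Dx; exact: le_trans (f0 _ Dx) (fg _ Dx).
apply: le_ereal_sup => _ [h /= hf <-]; exists h => //= x.
apply: le_trans (hf x) _.
by rewrite /patch; case: ifP => // /set_mem; exact: fg.
Qed.

(** * Lebesgue measure: cubes, balls, measurability of open sets *)

Section cube.
Context {R : realType}.

Definition cube {n} (c : 'rV[R]_n) (r : R) : set 'rV[R]_n :=
  [set v | forall i, v ord0 i \in `]c ord0 i - r, c ord0 i + r[].

Lemma measurable_cube n (c : 'rV[R]_n) r : measurable (cube c r).
Proof.
rewrite (_ : cube c r = \bigcap_(i in [set: 'I_n])
    ((fun v : 'rV[R]_n => v ord0 i) @^-1` `]c ord0 i - r, c ord0 i + r[)).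
  apply: fin_bigcap_measurable => // i _.
  by rewrite -[X in measurable X]setTI; exact: measurable_rV_coord.
by apply/seteqP; split=> [v cv i _|v cv i]; apply: cv.
Qed.

(** Induction on the dimension: under [cons_rV] a cube pulls back to an interval times a cube. Balls
    are later measured only by comparison with cubes. *)
Lemma lebesgue_rV_cube n (c : 'rV[R]_n) r : 0 < r ->
  lebesgue_rV n (cube c r) = ((2 * r) ^+ n)%:E.
Proof.
move=> r0; elim: n c => [|n IH] c.
  by rewrite /= diracE expr0 mem_set//= => -[].
have cE : @cons_rV R n @^-1` cube c r =
    `]c ord0 ord0 - r, c ord0 ord0 + r[ `*` cube (uncons_rV c).2 r.
  have ord0E : @lshift 1 n ord0 = ord0 by exact/val_inj.
  apply/seteqP; split=> [[a v] /= cv|[a v] /= [ca cv] i].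
    split; first by have := cv (@lshift 1 n ord0); rewrite cons_rVE0 ord0E.
    by move=> i /=; have := cv (rshift 1 i); rewrite cons_rVES /= mxE.
  case: (@splitP 1 n i) => j ij.
    have -> : i = lshift n j by exact/val_inj.
    by rewrite cons_rVE0 (ord1 j) ord0E.
  have -> : i = rshift 1 j by exact/val_inj.
  by rewrite cons_rVES; have := cv j; rewrite /= mxE.
rewrite /= /lebesgue_rV_step /pushforward cE product_measure1E//; last first.
  exact: measurable_cube.
rewrite IH /= lebesgue_measure_itv/= lte_fin ifT; last by lra.
by rewrite -EFinD -EFinM exprS; congr (_ * _)%:E; ring.
Qed.

End cube.

Section lebesgue_rV_theory.
Context {R : realType} {n : nat}.
Implicit Types (x y z : 'rV[R]_n) (r : R) (A : set 'rV[R]_n).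
Local Notation leb := (lebesgue_rV n).

Lemma eball_sub_cube x r : eball x r `<=` cube x r.
Proof.
move=> y; rewrite /eball/= => xy i; rewrite in_itv/=.
have := le_lt_trans (coord_le_enorm _ i) xy; rewrite !mxE ltr_norml; lra.
Qed.

Lemma cube_sub_eball x r : (0 < n)%N -> cube x (r / n%:R) `<=` eball x r.
Proof.
move=> n0 y xy; rewrite /eball/=; apply: le_lt_trans (enorm_le_sum _) _.
rewrite -[r](divfK (x := n%:R)) ?pnatr_eq0 -?lt0n//.
rewrite mulr_natr -[n in X in _ < X]card_ord -sumr_const.
apply: ltr_sum; last first.
  move=> i _; have := xy i; set t := r / n%:R.
  by rewrite in_itv/= !mxE card_ord -/t ltr_norml; lra.
by apply/hasP; exists (Ordinal n0) => //; rewrite mem_index_enum.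
Qed.

Lemma measurable_enorm : measurable_fun setT (@enorm R n).
Proof.
rewrite (_ : @enorm R n = (@powR R ^~ 2^-1) \o
    (fun x => \sum_(i < n) x ord0 i ^+ 2)); last first.
  by apply/funext => x /=; rewrite powR12_sqrt// sumr_ge0// => i _; exact: sqr_ge0.
apply: measurableT_comp; first exact: measurable_powR.
apply: measurable_sum => i; apply: measurable_funX.
exact: measurable_rV_coord.
Qed.

Lemma measurable_rVB : measurable_fun setT (fun xy : 'rV[R]_n * 'rV[R]_n => xy.1 - xy.2).
Proof.
apply: measurable_fun_rV => i.
rewrite (_ : (fun _ => _) = (fun xy : 'rV[R]_n * 'rV[R]_n => xy.1 ord0 i - xy.2 ord0 i)).
  by apply: measurable_funB; apply: (measurableT_comp (measurable_rV_coord i)).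
by apply/funext => xy; rewrite !mxE.
Qed.

Lemma measurable_enormB x : measurable_fun setT (fun y => enorm (y - x)).
Proof.
apply: (measurableT_comp measurable_enorm).
exact: (measurable_fun_pair1 x measurable_rVB).
Qed.

Lemma measurable_eball x r : measurable (eball x r).
Proof.
rewrite -[eball x r]setTI (_ : eball x r = (fun y => enorm (y - x)) @^-1` `]-oo, r[).
  exact: measurable_enormB.
by apply/seteqP; split=> y; rewrite /eball/= in_itv.
Qed.

(** The sigma-algebra is generated by coordinates, so [A] is written as a countable union of cubes
    with rational centre and radius. Dimension 0 is separate because radii get divided by [n]. *)
Lemma measurable_open_rV A : open A -> measurable A.
Proof.
have [n0|n0] := posnP n.
  move=> _; have [->|/set0P[x Ax]] := eqVneq A set0; first exact: measurable0.
  suff -> : A = setT by exact: measurableT.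
  apply/seteqP; split=> // y _; rewrite (_ : y = x)//.
  by apply/rowP => -[i ilt]; exfalso; move: ilt; rewrite {1}n0.
move=> oA.
pose rt (c : 'rV[rat]_n) : 'rV[R]_n := \row_i ratr (c ord0 i).
pose F (cr : 'rV[rat]_n * rat) : set 'rV[R]_n :=
  [set x | cube (rt cr.1) (ratr cr.2) x /\ cube (rt cr.1) (ratr cr.2) `<=` A].
rewrite (_ : A = \bigcup_cr F cr).
  apply: countable_bigcupT_measurable => // cr.
  have [cA|cA] := pselect (cube (rt cr.1) (ratr cr.2) `<=` A).
    rewrite (_ : F cr = cube (rt cr.1) (ratr cr.2)); first exact: measurable_cube.
    by apply/seteqP; split=> x; [case|split].
  rewrite (_ : F cr = set0); first exact: measurable0.
  by apply/seteqP; split=> x // [].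
apply/seteqP; split=> [x Ax|x [cr _ []]]; last by move=> cx; exact.
have [e e0 eA] := open_eballP _ _ oA Ax.
have n0' : 0 < n%:R :> R by rewrite ltr0n.
(* A cube of half-width [s] whose centre is within [s] of [x] lies in the cube of half-width 2s <
   e/n about [x], hence in the ball of radius [e]. *)
have [s] : exists s : rat, ratr s \in `]0, e / n%:R / 2[.
  by apply: rat_in_itvoo; rewrite !divr_gt0.
rewrite in_itv/= => /andP[s0 se].
have /choice[c cP] : forall i, exists t : rat,
    ratr t \in `]x ord0 i - ratr s, x ord0 i + ratr s[.
  by move=> i; apply: rat_in_itvoo; lra.
exists (\row_i c i, s) => //; split => /=.
  by move=> i; have := cP i; rewrite !in_itv/= !mxE; lra.
move=> y cy; apply/eA/(cube_sub_eball _ _ n0) => i.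
have := cy i; have := cP i; rewrite !in_itv/= !mxE; lra.
Qed.

Lemma lebesgue_rV_eball_le x r : 0 < r -> (leb (eball x r) <= ((2 * r) ^+ n)%:E)%E.
Proof.
move=> r0; rewrite -(lebesgue_rV_cube _ x)//.
by apply: le_measure; rewrite ?inE; [exact: measurable_eball|exact: measurable_cube|exact: eball_sub_cube].
Qed.

Lemma lebesgue_rV_eball_ge x r : (0 < n)%N -> 0 < r ->
  (((2 * (r / n%:R)) ^+ n)%:E <= leb (eball x r))%E.
Proof.
move=> n0 r0; rewrite -(lebesgue_rV_cube _ x) ?divr_gt0 ?ltr0n//.
by apply: le_measure; rewrite ?inE; [exact: measurable_cube|exact: measurable_eball|exact: cube_sub_eball].
Qed.

End lebesgue_rV_theory.

(** * Real powers and geometric domination of integrals *)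

Section powR_extra.
Context {R : realType}.
Implicit Types (a b r s : R).

Lemma exprn_powR a r (m : nat) : 0 <= a -> (a ^+ m) `^ r = (a `^ r) ^+ m.
Proof.
move=> a0; rewrite -(powR_mulrn m a0) -(powR_mulrn m (powR_ge0 a r)).
exact: powRAC.
Qed.

Lemma powRDp a r s : 0 < a -> a `^ (r + s) = a `^ r * a `^ s.
Proof. by move=> a0; rewrite powRD// (gt_eqF a0) implybT. Qed.

Lemma powRV a r : 0 <= a -> a^-1 `^ r = a `^ (- r).
Proof. by move=> a0; rewrite -powR_inv1// -powRrM mulN1r. Qed.

Lemma ler_powRN a b s : 0 < a -> a <= b -> 0 <= s -> b `^ (- s) <= a `^ (- s).
Proof.
move=> a0 ab s0; rewrite !powRN lef_pV2 ?posrE ?powR_gt0//; last exact: lt_le_trans ab.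
by rewrite ge0_ler_powR// nnegrE ltW//; exact: lt_le_trans ab.
Qed.

Lemma powR_lt1 a r : 0 < a < 1 -> 0 < r -> a `^ r < 1.
Proof.
move=> /andP[a0 a1] r0; rewrite -[X in _ < X](_ : 1 `^ r = 1); last by rewrite powR1.
by rewrite gt0_ltr_powR// nnegrE ?ltW.
Qed.

Lemma dyadic_ge1 a : 1 <= a -> exists m : nat, 2 ^+ m <= a < 2 ^+ m.+1.
Proof.
move=> a1; have a0 : 0 <= a by exact: le_trans a1.
have /andP[ta at'] := truncn_itv a0.
have t0 : (0 < Num.truncn a)%N by rewrite truncn_gt0.
have /andP[l1 l2] := trunc_log_bounds (isT : (1 < 2)%N) t0.
exists (trunc_log 2 (Num.truncn a)); apply/andP; split.
  by apply: le_trans ta; rewrite -natrX ler_nat.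
by apply: lt_le_trans at' _; rewrite -natrX ler_nat.
Qed.

End powR_extra.

(** At each point one [g m] dominates [f], hence so does the sum of all of them, which integrates
    term by term to at most a geometric series. *)
Lemma integral_geometric_le d (T : measurableType d) (R : realType)
    (mu : {measure set T -> \bar R}) (f : T -> \bar R) (g : nat -> T -> \bar R) (a z : R) :
  (forall x, 0 <= f x)%E -> (forall m, measurable_fun setT (g m)) ->
  (forall m x, 0 <= g m x)%E ->
  (forall x, exists m, f x <= g m x)%E ->
  (forall m, \int[mu]_x g m x <= (a * z ^+ m)%:E)%E -> 0 <= a -> 0 < z < 1 ->
  (\int[mu]_x f x <= (a / (1 - z))%:E)%E.
Proof.
move=> f0 mg g0 fg gz a0 /andP[z0 z1].
apply: (@le_trans _ _ (\int[mu]_x (\sum_(0 <= m <oo) g m x))%E).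
  apply: ge0_le_integral_nomeas => // x _.
  have [m fgm] := fg x; apply: le_trans fgm _.
  apply: le_trans (nneseries_lim_ge m.+1 _); last by move=> ? _ _; exact: g0.
  rewrite big_nat_recr//= leeDr// sume_ge0// => i _; exact: g0.
rewrite integral_nneseries//.
apply: lime_le.
  by apply: is_cvg_nneseries => ? _ _; exact: integral_ge0.
apply: nearW => m.
apply: (@le_trans _ _ (\sum_(0 <= i < m) (a * z ^+ i)%:E)%E).
  by apply: lee_sum => i _; exact: gz.
rewrite sumEFin lee_fin; have := @geometric_le_lim R m a z a0 z0.
by rewrite gtr0_norm//; exact.
Qed.

(** * The singular kernel attached to a ramp of width rho *)

Section kernel.
Context {R : realType} {n : nat}.
Implicit Types (x y : 'rV[R]_n) (rho delta p : R).
Local Notation leb := (lebesgue_rV n).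

(* Dominates [|u x - u y|^p / h^s] when [|u x - u y| <= min(1, h / rho)]. *)
Definition frac_kernel p s rho (h : R) : R := Num.min 1 (h / rho) `^ p * h `^ (- s).

Lemma frac_kernel_ge0 p s rho h : 0 <= frac_kernel p s rho h.
Proof. by rewrite /frac_kernel mulr_ge0 ?powR_ge0. Qed.

Lemma measurable_frac_kernel p s rho : measurable_fun setT (frac_kernel p s rho).
Proof.
apply: measurable_funM; last exact: measurable_powR.
apply: (measurableT_comp (measurable_powR p)); apply: measurable_minr => //.
exact: measurable_funM.
Qed.

Lemma integral_cst_eball_le x (c r a : R) : 0 <= c -> 0 < r ->
  c * (2 * r) ^+ n <= a ->
  (\int[leb]_y (c * \1_(eball x r) y)%:E <= a%:E)%E.
Proof.
move=> c0 r0 ca; under eq_integral do rewrite EFinM.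
rewrite ge0_integralZl//; last first.
  by apply/measurable_EFinP; apply: measurable_indic; exact: measurable_eball.
rewrite integral_indic ?setIT//; last exact: measurable_eball.
apply: le_trans (_ : (c%:E * ((2 * r) ^+ n)%:E <= _)%E); last by rewrite -EFinM lee_fin.
by rewrite lee_wpmul2l // lebesgue_rV_eball_le.
Qed.

(** Dyadic decomposition around the radius rho. Far rings, where the minimum is 1, contribute like
    2^(- m p delta), near rings like 2^(- m p (1 - delta)); both are summable since 0 < delta <
    1. *)
Lemma integral_frac_kernel_le p delta : 1 <= p -> 0 < delta < 1 ->
  exists2 K : R, 0 < K & forall rho x, 0 < rho ->
  (\int[leb]_y (frac_kernel p (n%:R + p * delta) rho (enorm (x - y)))%:E
     <= (K * rho `^ (- (p * delta)))%:E)%E.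
Proof.
move=> p1 /andP[d0 d1]; have p0 : 0 < p by lra.
set s := n%:R + p * delta; have s0 : 0 < s by rewrite ltr_wpDl// mulr_gt0.
pose z1 : R := 2^-1 `^ (p * delta); pose z2 : R := 2^-1 `^ (p * (1 - delta)).
have half : 0 < (2^-1 : R) < 1 by apply/andP; split; lra.
have z1lt : z1 < 1 by rewrite powR_lt1// mulr_gt0.
have z2lt : z2 < 1 by rewrite powR_lt1// mulr_gt0// subr_gt0.
have z10 : 0 < z1 by rewrite powR_gt0//; lra.
have z20 : 0 < z2 by rewrite powR_gt0//; lra.
(* The larger ratio lets a single geometric series dominate both families. *)
pose z := Num.max z1 z2.
have z01 : 0 < z < 1 by rewrite lt_max z10/= gt_max z1lt.
exists ((4 ^+ n + 4 ^+ n * 2 `^ s) / (1 - z)) => [|rho x rho0].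
  apply: divr_gt0; last by case/andP: z01; rewrite subr_gt0.
  by rewrite addr_gt0 ?mulr_gt0 ?exprn_gt0 ?powR_gt0.
(* [A m] bounds the kernel where rho 2^m <= h < rho 2^(m+1), and [B m] where rho 2^(-m-1) < h <= rho
   2^(-m). In [g] the rings are enlarged to balls, which costs only a constant factor. *)
pose A (m : nat) : R := (rho * 2 ^+ m) `^ (- s).
pose B (m : nat) : R := (2^-1 ^+ m) `^ p * (rho * 2^-1 ^+ m / 2) `^ (- s).
have A0 m : 0 <= A m by exact: powR_ge0.
have B0 m : 0 <= B m by rewrite mulr_ge0 ?powR_ge0.
pose g (m : nat) y := ((A m * \1_(eball x (rho * 2 ^+ m * 2)) y)%:E
                      + (B m * \1_(eball x (rho * 2^-1 ^+ m * 2)) y)%:E)%E.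
rewrite mulrAC; apply: (@integral_geometric_le _ _ _ _ _ g _ z) => //.
- by move=> y; rewrite lee_fin frac_kernel_ge0.
- move=> m; apply: emeasurable_funD; apply/measurable_EFinP;
    by apply: measurable_funM => //; apply: measurable_indic; exact: measurable_eball.
- by move=> m y; rewrite adde_ge0// lee_fin mulr_ge0.
- move=> y; have [->|xy] := eqVneq x y.
    exists 0%N; rewrite subrr enorm0 /frac_kernel mul0r min_r// (@powR0 _ p) ?(gt_eqF p0)//.
    by rewrite mul0r adde_ge0// lee_fin mulr_ge0.
  set h := enorm (x - y).
  have h0 : 0 < h.
    rewrite lt_neqAle enorm_ge0 andbT eq_sym; apply/negP => /eqP /enorm_eq0 /eqP.
    by rewrite subr_eq0 (negbTE xy).
  have hr0 : 0 < h / rho by rewrite divr_gt0.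
  have [t1|t1] := leP 1 (h / rho).
    have [m /andP[m1 m2]] := dyadic_ge1 _ t1; exists m.
    rewrite /g [X in (_ <= (_ * X)%:E + _)%E]indicE mem_set; last first.
      by rewrite /eball/= enormB -mulrA -exprSr -/h mulrC -ltr_pdivrMr.
    rewrite mulr1 -EFinD lee_fin /frac_kernel min_l// powR1 mul1r.
    apply: ler_wpDr; first exact: mulr_ge0.
    by apply: ler_powRN; rewrite ?mulr_gt0 ?exprn_gt0 1?mulrC -?ler_pdivlMr// ltW.
  have [m /andP[m1 m2]] : exists m : nat, 2 ^+ m <= (h / rho)^-1 < 2 ^+ m.+1.
    by apply: dyadic_ge1; rewrite invf_ge1 ?ltW.
  have m1' : h / rho <= 2^-1 ^+ m.
    by rewrite exprVn -[h / rho]invrK lef_pV2// ?posrE ?exprn_gt0// invr_gt0.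
  have m2' : 2^-1 ^+ m / 2 < h / rho.
    rewrite -exprSr exprVn -[h / rho]invrK ltf_pV2// ?posrE ?exprn_gt0//.
    by rewrite invr_gt0.
  exists m; rewrite /g [X in (_ <= _ + (_ * X)%:E)%E]indicE mem_set; last first.
    rewrite /eball/= enormB -mulrA mulrC -ltr_pdivrMr// -/h.
    by apply: le_lt_trans m1' _; rewrite ltr_pMr ?exprn_gt0//; lra.
  rewrite mulr1 -EFinD lee_fin /frac_kernel min_r ?(ltW t1)//.
  apply: ler_wpDl; first exact: mulr_ge0.
  apply: ler_pM; rewrite ?powR_ge0//.
    by apply: ge0_ler_powR; rewrite // ?nnegrE ?exprn_ge0 ?invr_ge0// ltW.
  apply: ler_powRN; last exact: ltW.
    by rewrite !mulr_gt0 ?exprn_gt0//; lra.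
  by rewrite -mulrA mulrC -ler_pdivlMr// ltW.
- move=> m; rewrite ge0_integralD//; last 4 first.
  + by move=> y _; rewrite lee_fin mulr_ge0.
  + by apply/measurable_EFinP; apply: measurable_funM => //; apply: measurable_indic; exact: measurable_eball.
  + by move=> y _; rewrite lee_fin mulr_ge0.
  + by apply/measurable_EFinP; apply: measurable_funM => //; apply: measurable_indic; exact: measurable_eball.
  have two0 : 0 < (2 ^+ m : R) by rewrite exprn_gt0.
  have half0 : 0 < (2^-1 ^+ m : R) by rewrite exprn_gt0//; lra.
  apply: (@le_trans _ _ ((4 ^+ n * rho `^ (- (p * delta)) * z1 ^+ m)%:E +
    (4 ^+ n * 2 `^ s * rho `^ (- (p * delta)) * z2 ^+ m)%:E)%E).
    apply: leeD.
      apply: integral_cst_eball_le; rewrite ?mulr_gt0//.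
      rewrite (_ : 2 * (rho * 2 ^+ m * 2) = 4 * (rho * 2 ^+ m)); last by ring.
      rewrite exprMn mulrCA -!mulrA; apply: ler_wpM2l; first exact: exprn_ge0.
      rewrite -[(rho * _) ^+ n]powR_mulrn ?mulr_ge0 ?(ltW rho0) ?(ltW two0)// /A -powRDp ?mulr_gt0//.
      rewrite (_ : - s + n%:R = - (p * delta)); last by rewrite /s; ring.
      rewrite powRM ?(ltW rho0) ?(ltW two0)//; apply: ler_wpM2l; first exact: powR_ge0.
      by rewrite /z1 powRV// exprn_powR.
    apply: integral_cst_eball_le; rewrite ?mulr_gt0//.
    rewrite (_ : 2 * (rho * 2^-1 ^+ m * 2) = 4 * (rho * 2^-1 ^+ m)); last by ring.
    rewrite exprMn mulrCA -!mulrA; apply: ler_wpM2l; first exact: exprn_ge0.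
    rewrite /B.
    rewrite [rho * (_ / 2)]mulrA powRM ?invr_ge0 ?mulr_ge0 ?(ltW rho0) ?(ltW half0)//.
    rewrite -[(rho * _) ^+ n]powR_mulrn ?mulr_ge0 ?(ltW rho0) ?(ltW half0)//.
    have -> : 2^-1 `^ (- s) = 2 `^ s.
      by rewrite powRV// opprK.
    rewrite [X in X <= _](_ : _ = 2 `^ s * ((2^-1 ^+ m) `^ p *
      ((rho * 2^-1 ^+ m) `^ (- s) * (rho * 2^-1 ^+ m) `^ n%:R))); last by ring.
    rewrite -powRDp ?mulr_gt0// (_ : - s + n%:R = - (p * delta)); last by rewrite /s; ring.
    rewrite powRM ?(ltW rho0) ?(ltW half0)// [X in _ * X](_ : _ =
      rho `^ (- (p * delta)) * ((2^-1 ^+ m) `^ p * (2^-1 ^+ m) `^ (- (p * delta))));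
      last by ring.
    by rewrite -powRDp// (_ : p + - (p * delta) = p * (1 - delta)) ?exprn_powR//; ring.
  have z1m : z1 ^+ m <= z ^+ m.
    by apply: lerXn2r; rewrite ?nnegrE ?(ltW z10) ?le_max ?(ltW z10) ?lexx.
  have z2m : z2 ^+ m <= z ^+ m.
    by apply: lerXn2r; rewrite ?nnegrE ?(ltW z20) ?le_max ?(ltW z20) ?lexx ?orbT.
  have r0 : 0 <= rho `^ (- (p * delta)) by exact: powR_ge0.
  rewrite -EFinD lee_fin !mulrDl; apply: lerD; apply: ler_wpM2l => //.
    by rewrite mulr_ge0 ?exprn_ge0.
  by rewrite !mulr_ge0 ?exprn_ge0 ?powR_ge0.
- by rewrite mulr_ge0 ?powR_ge0// addr_ge0 ?mulr_ge0 ?exprn_ge0 ?powR_ge0.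
Qed.

End kernel.

(** * Distance to a nonempty boundary *)

Section bdist_theory.
Context {R : realType} {n : nat} (Omega : set 'rV[R]_n).
Hypothesis bOmega : boundary Omega !=set0.
Implicit Types (x y : 'rV[R]_n).

Lemma bdist_has_lbound x : has_lbound [set enorm (x - y) | y in boundary Omega].
Proof. by exists 0 => _ [y _ <-]; exact: enorm_ge0. Qed.

Lemma bdist_le x y : boundary Omega y -> bdist Omega x <= enorm (x - y).
Proof. by move=> By; apply: ge_inf; [exact: bdist_has_lbound|exists y]. Qed.

Lemma le_bdist x r : (forall y, boundary Omega y -> r <= enorm (x - y)) ->
  r <= bdist Omega x.
Proof.
move=> xr; apply: lb_le_inf; last by move=> _ [y By <-]; exact: xr.
by have [y By] := bOmega; exists (enorm (x - y)); exists y.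
Qed.

Lemma bdist_lipschitz x y : bdist Omega x <= enorm (x - y) + bdist Omega y.
Proof.
rewrite -lerBlDl; apply: le_bdist => z Bz.
by rewrite lerBlDl; apply: le_trans (bdist_le x z Bz) (enormBD y _ _).
Qed.

Lemma bdist_gt0 x : open Omega -> Omega x -> 0 < bdist Omega x.
Proof.
move=> oO Ox; have [r r0 rO] := open_eballP _ _ oO Ox.
apply: lt_le_trans r0 _; apply: le_bdist => y [_ By]; rewrite leNgt.
apply/negP => xy; apply: By; rewrite (iffLR (interior_id _) oO).
by apply: rO; rewrite /eball/= enormB.
Qed.

Lemma eball_bdist_sub x : Omega x -> eball x (bdist Omega x) `<=` Omega.
Proof.
move=> Ox y xy; apply: contrapT => Oy.
have [z xyz Bz] := segment_boundary _ _ _ Ox Oy.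
have := bdist_le x z Bz; apply/negP; rewrite -ltNge.
apply: le_lt_trans xy; rewrite (enormB y) -(segment_enorm _ _ _ xyz).
by rewrite lerDl enorm_ge0.
Qed.

Lemma segment_bdist_sub x y : Omega x -> eball x (bdist Omega x) y ->
  segment x y `<=` Omega.
Proof.
move=> Ox xy; apply: subset_trans (eball_bdist_sub x Ox).
by apply: segment_sub_eball; rewrite enormB.
Qed.

End bdist_theory.

Lemma le_integral_subset d (T : measurableType d) (R : realType)
    (mu : {measure set T -> \bar R}) (D : set T) (f g : T -> \bar R) :
  (forall x, D x -> 0 <= f x)%E -> (forall x, 0 <= g x)%E ->
  (forall x, D x -> f x <= g x)%E ->
  (\int[mu]_(x in D) f x <= \int[mu]_x g x)%E.
Proof.
move=> f0 g0 fg; rewrite integral_mkcond; apply: ge0_le_integral_nomeas => x _.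
  by apply: erestrict_ge0.
by rewrite /patch; case: ifP => // /set_mem; exact: fg.
Qed.

(** * Energy from above, deviation from a constant from below *)

Section energy.
Context {R : realType} {n : nat}.
Implicit Types (Omega A : set 'rV[R]_n) (u : 'rV[R]_n -> R).
Local Notation leb := (lebesgue_rV n).

(** The integrand is at most the kernel times 1_A(x) + 1_A(y). The first term is integrated in y
    with [integral_frac_kernel_le], then over [A]; the second equals the first by Tonelli and the
    symmetry of the kernel, whence the constant 2K. *)
Lemma fractional_energy_le p delta : 1 <= p -> 0 < delta < 1 ->
  exists2 K : R, 0 < K & forall Omega u A (rho a : R), 0 < rho ->
  measurable A -> (leb A <= a%:E)%E ->
  (forall x y, Omega x -> Omega y -> eball x (bdist Omega x) y ->
    [/\ `|u x - u y| <= 1, `|u x - u y| <= enorm (x - y) / rho &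
        u x != u y -> A x \/ A y]) ->
  (fractional_energy delta p 1 Omega u <= (K * (rho `^ (- (p * delta)) * a))%:E)%E.
Proof.
move=> p1 d01; have [K K0 Kk] := @integral_frac_kernel_le R n p delta p1 d01.
exists (2 * K); first by rewrite mulr_gt0.
move=> Omega u A rho a rho0 mA Aa uA.
set s := n%:R + p * delta in Kk *.
pose k (xy : 'rV[R]_n * 'rV[R]_n) := frac_kernel p s rho (enorm (xy.1 - xy.2)).
have k0 xy : 0 <= k xy by exact: frac_kernel_ge0.
have mk : measurable_fun setT k.
  apply: (measurableT_comp (measurable_frac_kernel p s rho)).
  exact: (measurableT_comp measurable_enorm measurable_rVB).
pose f1 (xy : 'rV[R]_n * 'rV[R]_n) := (\1_A xy.1 * k xy)%:E.
pose f2 (xy : 'rV[R]_n * 'rV[R]_n) := (\1_A xy.2 * k xy)%:E.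
have f10 xy : (0 <= f1 xy)%E by rewrite lee_fin mulr_ge0.
have f20 xy : (0 <= f2 xy)%E by rewrite lee_fin mulr_ge0.
have m1A : measurable_fun setT (\1_A : 'rV[R]_n -> R) by exact: measurable_indic.
have mf1 : measurable_fun setT f1.
  apply/measurable_EFinP; apply: measurable_funM => //.
  exact: (measurableT_comp m1A).
have mf2 : measurable_fun setT f2.
  apply/measurable_EFinP; apply: measurable_funM => //.
  exact: (measurableT_comp m1A).
have I1 : (\int[leb]_x \int[leb]_y f1 (x, y) <= (K * (rho `^ (- (p * delta)) * a))%:E)%E.
  apply: (@le_trans _ _ (\int[leb]_x ((K * rho `^ (- (p * delta)))%:E * (\1_A x)%:E))%E).
    apply: ge0_le_integral_nomeas => x _; first by apply: integral_ge0 => y _.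
    have -> : (\int[leb]_y f1 (x, y) =
        (\1_A x)%:E * \int[leb]_y (k (x, y))%:E)%E.
      rewrite -ge0_integralZl//.
      by apply/measurable_EFinP; exact: (measurable_fun_pair2 x mk).
      by move=> y _; rewrite lee_fin.
    rewrite muleC; apply: lee_wpmul2r; first by rewrite lee_fin.
    exact: Kk.
  rewrite ge0_integralZl//; last 2 first.
  - exact/measurable_EFinP.
  - by rewrite lee_fin mulr_ge0 ?powR_ge0 ?ltW.
  rewrite integral_indic// setIT mulrA [leRHS]EFinM.
  by apply: lee_wpmul2l => //; rewrite lee_fin mulr_ge0 ?powR_ge0 ?ltW.
have I2 : (\int[leb]_x \int[leb]_y f2 (x, y) <= (K * (rho `^ (- (p * delta)) * a))%:E)%E.
  have -> := fubini_tonelli (m1 := leb) (m2 := leb) f2 mf2 f20.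
  suff -> : (\int[leb]_y \int[leb]_x f2 (x, y) =
      \int[leb]_x \int[leb]_y f1 (x, y))%E by exact: I1.
  apply: eq_integral => x _; apply: eq_integral => y _.
  by rewrite /f1 /f2 /k/= enormB.
apply: (@le_trans _ _ (\int[leb]_x (\int[leb]_y f1 (x, y) + \int[leb]_y f2 (x, y)))%E).
  apply: le_integral_subset.
  - by move=> x _; apply: integral_ge0 => y _; rewrite lee_fin divr_ge0 ?powR_ge0.
  - by move=> x; apply: adde_ge0; apply: integral_ge0.
  move=> x Ox.
  have -> : (\int[leb]_y f1 (x, y) + \int[leb]_y f2 (x, y) =
      \int[leb]_y (f1 (x, y) + f2 (x, y)))%E.
    apply/esym; apply: ge0_integralD.
    - exact: measurableT.
    - by move=> y _; exact: f10.
    - exact: (measurable_fun_pair2 x mf1).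
    - by move=> y _; exact: f20.
    - exact: (measurable_fun_pair2 x mf2).
  apply: le_integral_subset.
  - by move=> y _; rewrite lee_fin divr_ge0 ?powR_ge0.
  - by move=> y; rewrite adde_ge0.
  move=> y [Oy]; rewrite mul1r => xy; rewrite -EFinD lee_fin -mulrDl.
  have [u1 u2 uxy] := uA _ _ Ox Oy xy.
  have [uE|une] := eqVneq (u x) (u y).
    rewrite uE subrr normr0 powR0; last by rewrite gt_eqF//; lra.
    by rewrite mul0r; apply: mulr_ge0 => //; exact: addr_ge0.
  have ukk : `|u x - u y| `^ p / enorm (x - y) `^ s <= k (x, y).
    rewrite /k /frac_kernel powRN ler_wpM2r ?invr_ge0 ?powR_ge0//.
    apply: ge0_ler_powR; rewrite ?nnegrE//; first by lra.
      by rewrite le_min ler01 divr_ge0 ?enorm_ge0 ?ltW.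
    by rewrite le_min u1.
  apply: le_trans ukk _; rewrite -[X in X <= _]mul1r ler_wpM2r//= !indicE.
  by have [|] := uxy une => /mem_set ->; rewrite ?lerDl ?lerDr.
rewrite ge0_integralD//; last 4 first.
- by move=> x _; exact: integral_ge0.
- exact: (measurable_fun_fubini_tonelli_F _ mf1 f10).
- by move=> x _; exact: integral_ge0.
- exact: (measurable_fun_fubini_tonelli_F _ mf2 f20).
by apply: le_trans (leeD I1 I2) _; rewrite -EFinD lee_fin; lra.
Qed.

(** Whatever [m] is, it is at distance at least 1/2 from 1 or from 0, so [u] deviates from it on all
    of [P] or on all of [Z]. The mean of a test function therefore never has to be computed. *)
Lemma deviation_ge Omega u P Z (m q c : R) : 0 < q ->
  measurable Omega -> measurable P -> measurable Z ->
  P `<=` Omega -> Z `<=` Omega ->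
  (forall x, P x -> u x = 1) -> (forall x, Z x -> u x = 0) ->
  (c%:E <= leb P)%E -> (c%:E <= leb Z)%E ->
  ((2^-1 `^ q * c)%:E <= \int[leb]_(x in Omega) (`|u x - m| `^ q)%:E)%E.
Proof.
move=> q0 mO mP mZ PO ZO uP uZ cP cZ.
suff H S : measurable S -> S `<=` Omega -> (c%:E <= leb S)%E ->
    (forall x, S x -> 2^-1 <= `|u x - m|) ->
    ((2^-1 `^ q * c)%:E <= \int[leb]_(x in Omega) (`|u x - m| `^ q)%:E)%E.
  have [m2|m2] := leP m 2^-1.
    by apply: (H P) => // x /uP ->; rewrite ger0_norm; lra.
  by apply: (H Z) => // x /uZ ->; rewrite sub0r normrN ger0_norm; lra.
move=> mS SO cS uS.
apply: (@le_trans _ _ (\int[leb]_(x in Omega) ((2^-1 `^ q)%:E * (\1_S x)%:E))%E).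
  rewrite ge0_integralZl//; last first.
    by apply/measurable_EFinP; exact: measurable_indic.
  rewrite integral_indic// setIidl// [leLHS]EFinM.
  by apply: lee_wpmul2l => //; rewrite lee_fin powR_ge0.
apply: ge0_le_integral_nomeas => x Ox; first by rewrite -EFinM lee_fin mulr_ge0 ?powR_ge0.
rewrite -EFinM lee_fin indicE; case: (boolP (x \in S)) => [/set_mem Sx|_].
  by rewrite mulr1; apply: ge0_ler_powR (uS _ Sx); rewrite ?nnegrE ?invr_ge0// ltW.
by rewrite mulr0 powR_ge0.
Qed.

End energy.

(** * The Sobolev-Poincaré inequality as a capacity estimate *)

Section sobolev_poincare.
Context {R : realType} {n : nat} (Omega : set 'rV[R]_n) (p q delta : R).
Local Notation leb := (lebesgue_rV n).
Hypothesis oOmega : open Omega.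
Hypothesis bOmega : boundary Omega !=set0.
Hypothesis finOmega : (leb Omega < +oo)%E.

(** [deviation_ge] bounds the left side of the inequality from below and [fractional_energy_le]
    bounds the right side from above. What is controlled is the smaller of the measures of [P] and
    [Z]. *)
Lemma sobolev_poincare_capacity : 1 <= p -> p < q -> 0 < delta < 1 ->
  fractional_sobolev_poincare delta q p 1 Omega ->
  exists2 K : R, 0 < K & forall (u : 'rV[R]_n -> R) A P Z (rho a c : R), 0 < rho ->
  measurable A -> measurable P -> measurable Z -> measurable_fun setT u ->
  (forall x, 0 <= u x <= 1) ->
  (leb A <= a%:E)%E ->
  (forall x y, Omega x -> Omega y -> eball x (bdist Omega x) y ->
    `|u x - u y| <= enorm (x - y) / rho /\ (u x != u y -> A x \/ A y)) ->
  P `<=` Omega -> Z `<=` Omega ->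
  (forall x, P x -> u x = 1) -> (forall x, Z x -> u x = 0) ->
  (c%:E <= leb P)%E -> (c%:E <= leb Z)%E ->
  c <= K * (rho `^ (- (p * delta)) * a) `^ (q / p).
Proof.
move=> p1 pq d01 [C1 C10 SP].
have [K K0 HK] := @fractional_energy_le R n p delta p1 d01.
have q0 : 0 < q by lra.
have h0 : 0 < (2^-1 : R) `^ q by rewrite powR_gt0//; lra.
exists (C1 * K `^ (q / p) / 2^-1 `^ q).
  by rewrite !mulr_gt0 ?invr_gt0 ?powR_gt0.
move=> u A P Z rho a c rho0 mA mP mZ mu u01 Aa uA PO ZO uP uZ cP cZ.
have mO : measurable Omega by exact: measurable_open_rV.
have a0 : 0 <= a by rewrite -lee_fin; apply: le_trans Aa.
have u1 x y : `|u x - u y| <= 1.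
  by have := u01 x; have := u01 y; rewrite ler_norml => /andP[? ?] /andP[? ?]; lra.
have cu : {within Omega, continuous u}.
  apply: continuous_in_subspaceT => x /set_mem Ox.
  apply/(@cvgrPdist_lt _ R^o _ _ (nbhs_filter x)) => e e0; apply/nbhs_ballP.
  (* The Lipschitz bound on [u] is available only within [bdist Omega x] of [x]. Dividing by n + 1
     passes from the sup norm to the Euclidean norm without a zero divisor. *)
  pose d := Num.min (bdist Omega x) (rho * e) / n.+1%:R.
  have d0 : 0 < d.
    by rewrite divr_gt0 ?ltr0n// lt_min (bdist_gt0 _ bOmega)//= mulr_gt0.
  exists d => //= y; rewrite -ball_normE/= ltr_pdivlMr ?ltr0n// => xyd.
  have xy : enorm (x - y) < Num.min (bdist Omega x) (rho * e).
    apply: le_lt_trans xyd; apply: le_trans (enorm_le_norm _) _.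
    by rewrite mulrC ler_wpM2l// ler_nat.
  move: xy; rewrite lt_min => /andP[xy1 xy2].
  have Bxy : eball x (bdist Omega x) y by rewrite /eball/= enormB.
  have [uxy _] := uA _ _ Ox (eball_bdist_sub _ _ Ox _ Bxy) Bxy.
  by apply: le_lt_trans uxy _; rewrite ltr_pdivrMr// mulrC.
have iu : leb.-integrable Omega (EFin \o u).
  apply: measurable_bounded_integrable => //; first exact: measurable_funTS.
  exists 1; split => // M M1 x _ /=; have /andP[ux0 ux1] := u01 x.
  by rewrite ger0_norm//; apply: le_trans ux1 (ltW M1).
have := SP u cu iu.
have := deviation_ge Omega u P Z (mean Omega u) q c q0 mO mP mZ PO ZO uP uZ cP cZ.
move=> /le_trans /[apply] H.
have E : (fractional_energy delta p 1 Omega u <= (K * (rho `^ (- (p * delta)) * a))%:E)%E.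
  apply: (HK _ _ A) => //.
  by move=> x y Ox Oy Bxy; have [? ?] := uA _ _ Ox Oy Bxy; split.
have E0 : (0 <= fractional_energy delta p 1 Omega u)%E.
  apply: integral_ge0 => x _; apply: integral_ge0 => y _.
  by rewrite lee_fin divr_ge0 ?powR_ge0.
rewrite [leRHS]mulrAC ler_pdivlMr// mulrC -lee_fin; apply: le_trans H _.
rewrite -mulrA -powRM ?(ltW K0) ?mulr_ge0 ?powR_ge0// EFinM.
apply: lee_wpmul2l; first by rewrite lee_fin ltW.
rewrite -poweR_EFin; apply: gt0_ler_poweR => //.
- by rewrite divr_ge0//; lra.
- by rewrite in_itv/= E0 leey.
- by rewrite in_itv/= leey andbT lee_fin !mulr_ge0 ?powR_ge0 ?(ltW K0).
Qed.

End sobolev_poincare.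

(** * Stampacchia's iteration *)

Section stampacchia.
Context {R : realType}.

Lemma powR_gt1 (a r : R) : 1 < a -> 0 < r -> 1 < a `^ r.
Proof.
move=> a1 r0; have := @gt0_ltr_powR R r r0 1 a.
by rewrite powR1 !nnegrE; apply; rewrite ?ler01 ?ltW// (lt_trans _ a1).
Qed.

Lemma geometric_le_eq0 (x a z : R) : 0 <= x -> 0 < z < 1 ->
  (forall j : nat, x <= a * z ^+ j) -> x = 0.
Proof.
move=> x0 /andP[z0 z1] xa; apply/eqP; rewrite eq_le x0 andbT.
have ga := @cvg_geometric R a z; rewrite gtr0_norm// in ga.
rewrite -(cvg_lim _ (ga z1))//; apply: limr_ge; first exact: cvgP (ga z1).
by apply: nearW => j; exact: xa.
Qed.

(** Along the radii r1 + D (1 - 2^(-j)) the values of [m] decay like th^j, with th < 1 because b >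
    1; by monotonicity [m] vanishes at the limit radius r1 + D. *)
Lemma stampacchia (K alpha b : R) : 0 < K -> 0 < alpha -> 1 < b ->
  exists2 C : R, 0 < C & forall (m : R -> R) (r1 : R),
  (forall r, 0 <= m r) -> {homo m : r r' / r <= r' >-> r' <= r} ->
  (forall r r', r1 <= r -> r < r' -> m r' <= K * ((r' - r) `^ (- alpha) * m r) `^ b) ->
  m (r1 + C * m r1 `^ ((b - 1) / (alpha * b))) = 0.
Proof.
move=> K0 al0 b1; have b0 : 0 < b by lra.
have ab0 : 0 < alpha * b by rewrite mulr_gt0.
pose G : R := 2 `^ (alpha * b); have G0 : 0 < G by rewrite powR_gt0.
(* Halving the radius step costs a factor G each time; th solves G th^b = th, so the power b absorbs
   that loss. *)
pose th : R := G `^ (- (b - 1)^-1); have th0 : 0 < th by rewrite powR_gt0.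
have thG : G * th `^ b = th.
  have -> : th `^ b = th * th `^ (b - 1).
    by rewrite -[X in X * _]powRr1 ?ltW// -powRDp//; congr (_ `^ _); ring.
  rewrite {2}/th -powRrM mulNr mulVf ?gt_eqF ?subr_gt0//.
  by rewrite powRN powRr1 ?ltW// mulrCA mulfV ?gt_eqF// mulr1.
have G1 : 1 < G.
  by apply: powR_gt1 => //; lra.
have th1 : th < 1.
  by rewrite /th powRN invf_lt1 ?powR_gt0// powR_gt1// invr_gt0 subr_gt0.
clearbody th.
(* This choice gives D^(alpha b) = K M^(b-1) G / th, for which the bound of the induction step
   equals M th^(j+1) exactly. *)
exists ((K * G / th) `^ (alpha * b)^-1) => [|m r1 m0 mni mK].
  by rewrite powR_gt0// divr_gt0// mulr_gt0.
set C := _ `^ (alpha * b)^-1.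
set M := m r1; set D := C * _.
have C0 : 0 < C by rewrite powR_gt0// divr_gt0// mulr_gt0.
(* The iteration needs D > 0 to have strictly increasing radii; for M = 0 monotonicity alone
   suffices. *)
have [M0|M0] := eqVneq M 0.
  apply/eqP; rewrite eq_le m0 andbT -[leRHS]M0 mni// lerDl.
  by rewrite mulr_ge0 ?powR_ge0 ?ltW.
have {}M0 : 0 < M by rewrite lt_neqAle eq_sym M0 m0.
have D0 : 0 < D by apply: mulr_gt0 => //; exact: powR_gt0.
have DE : D `^ (alpha * b) = K * M `^ (b - 1) * G / th.
  rewrite powRM ?(ltW C0) ?powR_ge0// -!powRrM.
  rewrite mulVf ?gt_eqF// divfK ?gt_eqF// powRr1; first by ring.
  by rewrite divr_ge0 ?mulr_ge0 ?ltW.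
have decay (j : nat) : m (r1 + D * (1 - 2^-1 ^+ j)) <= M * th ^+ j.
  elim: j => [|j IH]; first by rewrite expr0 subrr mulr0 addr0 mulr1.
  have h0 : 0 < (2^-1 ^+ j : R) by rewrite exprn_gt0.
  have hle : (2^-1 ^+ j : R) <= 1 by rewrite exprn_ile1//; lra.
  apply: le_trans (mK (r1 + D * (1 - 2^-1 ^+ j)) _ _ _) _.
  - by rewrite lerDl mulr_ge0 ?subr_ge0// (ltW D0).
  - by rewrite ltrD2l ltr_pM2l// ltrD2l ltrN2 exprS; lra.
  have -> : r1 + D * (1 - 2^-1 ^+ j.+1) - (r1 + D * (1 - 2^-1 ^+ j)) =
      D * 2^-1 ^+ j.+1 by rewrite exprS; field.
  apply: (@le_trans _ _ (K * ((D * 2^-1 ^+ j.+1) `^ (- alpha) * (M * th ^+ j)) `^ b)).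
    rewrite ler_pM2l//; apply: ge0_ler_powR; first exact: ltW.
    - by rewrite nnegrE mulr_ge0 ?powR_ge0.
    - by rewrite nnegrE mulr_ge0 ?powR_ge0 ?mulr_ge0 ?exprn_ge0 ?ltW.
    - by rewrite ler_wpM2l ?powR_ge0.
  have hh0 : 0 < (2^-1 ^+ j.+1 : R) by rewrite exprn_gt0.
  rewrite powRM ?powR_ge0 ?mulr_ge0 ?exprn_ge0 ?(ltW M0) ?(ltW th0)//.
  rewrite [(M * _) `^ b]powRM ?exprn_ge0 ?(ltW M0) ?(ltW th0)//.
  rewrite -powRrM mulNr powRN powRM ?(ltW D0) ?(ltW hh0)// DE.
  rewrite !exprn_powR ?(ltW th0)// powRV// powRN -/G.
  have -> : M `^ b = M * M `^ (b - 1).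
    by rewrite -[X in X * _]powRr1 ?ltW// -powRDp//; congr (_ `^ _); ring.
  have thj : th ^+ j = G ^+ j * th `^ b ^+ j by rewrite -exprMn thG.
  have Mb : 0 < M `^ (b - 1) by rewrite powR_gt0.
  have Gj : 0 < G ^+ j by rewrite exprn_gt0.
  rewrite exprVn !exprS thj.
  move: (th `^ b ^+ j) (G ^+ j) (M `^ (b - 1)) Gj Mb => tj Gn Mn Gn0 Mn0.
  clear -K0 G0 th0 Gn0 Mn0; rewrite le_eqVlt; apply/predU1P; left; field.
  by rewrite !gt_eqF.
apply: (@geometric_le_eq0 _ M th) => //; first by rewrite th0.
move=> j; apply: le_trans (decay j); apply: mni; rewrite lerD2l.
by rewrite ler_piMr ?(ltW D0)// gerBl exprn_ge0.
Qed.

End stampacchia.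

(** * Linear ramps and the test functions built from them *)

Section ramp.
Context {R : realType}.
Implicit Types (r a b : R).

Definition ramp (r0 r1 a : R) : R := Num.max 0 (Num.min 1 ((a - r0) / (r1 - r0))).

Lemma ramp_itv (r0 r1 : R) a : 0 <= ramp r0 r1 a <= 1.
Proof. by rewrite /ramp le_max lexx ge_max ler01 ge_min lexx. Qed.

Lemma ramp_eq0 (r0 r1 : R) a : r0 < r1 -> a <= r0 -> ramp r0 r1 a = 0.
Proof.
move=> r01 ar; rewrite /ramp max_l// ge_min; apply/orP; right.
by rewrite mulr_le0_ge0 ?invr_ge0; lra.
Qed.

Lemma ramp_eq1 (r0 r1 : R) a : r0 < r1 -> r1 <= a -> ramp r0 r1 a = 1.
Proof.
move=> r01 ar; rewrite /ramp min_l ?max_r// ler_pdivlMr; lra.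
Qed.

Lemma ramp_lipschitz (r0 r1 : R) a b : r0 < r1 ->
  `|ramp r0 r1 a - ramp r0 r1 b| <= `|a - b| / (r1 - r0).
Proof.
move=> r01; rewrite -[r1 - r0]ger0_norm; last by lra.
rewrite -normf_div (_ : (a - b) / _ = (a - r0) / (r1 - r0) - (b - r0) / (r1 - r0)); last first.
  by rewrite -mulrBl; congr (_ / _); ring.
rewrite /ramp; set s := (a - r0) / _; set t := (b - r0) / _.
have := ler_norm (s - t); have := ler_norm (t - s); rewrite (distrC t s).
have := normr_ge0 (s - t); rewrite ler_norml.
have clamp (x : R) : [\/ Num.max 0 (Num.min 1 x) = 0 /\ x <= 0,
    Num.max 0 (Num.min 1 x) = 1 /\ 1 <= x |
    Num.max 0 (Num.min 1 x) = x /\ 0 <= x <= 1].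
  have [x1|x1] := leP 1 x; first by apply: Or32; rewrite max_r.
  by have [x0|x0] := leP 0 x; [apply: Or33; rewrite ltW|apply: Or31; rewrite ltW].
by case: (clamp s) => -[-> ?]; case: (clamp t) => -[-> ?]; lra.
Qed.

Lemma measurable_ramp (r0 r1 : R) : measurable_fun setT (ramp r0 r1).
Proof.
apply: measurable_maxr => //; apply: measurable_minr => //.
by apply: measurable_funM => //; exact: measurable_funB.
Qed.

End ramp.

Section ramp_capacity.
Context {R : realType} {n : nat} (Omega : set 'rV[R]_n) (p q delta : R).
Local Notation leb := (lebesgue_rV n).
Hypothesis oOmega : open Omega.
Hypothesis bOmega : boundary Omega !=set0.
Hypothesis finOmega : (leb Omega < +oo)%E.
Hypotheses (p1 : 1 <= p) (pq : p < q) (d01 : 0 < delta < 1).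
Hypothesis SP : fractional_sobolev_poincare delta q p 1 Omega.

(** What is kept of a component of [Omega] minus a sphere: pairs seen by the energy are separated by
    [T] only across the closed ball, where a ramp starting at [r] or later vanishes. The whole space
    also qualifies, which gives the bumps of [sobolev_exponent_le]. *)
Definition cut_off_by (T : set 'rV[R]_n) (y0 : 'rV[R]_n) (r : R) :=
  forall x y : 'rV[R]_n, Omega x -> Omega y ->
  eball x (bdist Omega x) y -> T x <> T y ->
  exists2 w, segment x y w & enorm (w - y0) <= r.

(** On one side of [T] this is the Lipschitz bound of the ramp. Across [T] the segment contains a
    point where the ramp is 0, and the distance from the endpoint in [T] to that point is at most |x
    - y|. *)
Lemma cut_off_lipschitz T y0 r r0 r1 x y : cut_off_by T y0 r -> r <= r0 ->
  r0 < r1 -> Omega x -> Omega y -> eball x (bdist Omega x) y ->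
  `|\1_T x * ramp r0 r1 (enorm (x - y0)) - \1_T y * ramp r0 r1 (enorm (y - y0))|
    <= enorm (x - y) / (r1 - r0).
Proof.
move=> cT rr r01 Ox Oy xy.
have rho0 : 0 < (r1 - r0)^-1 by rewrite invr_gt0 subr_gt0.
have rampL z w : `|ramp r0 r1 (enorm (z - y0)) - ramp r0 r1 (enorm (w - y0))|
    <= enorm (z - w) / (r1 - r0).
  apply: le_trans (ramp_lipschitz _ _ _ _ r01) _; rewrite ler_pM2r//.
  rewrite ler_norml; have := enormBD w z y0; have := enormBD z w y0.
  by rewrite (enormB w z); lra.
have [TE|TE] := pselect (T x = T y).
  have -> : \1_T y = \1_T x :> R.
    rewrite !indicE; suff -> : (y \in T) = (x \in T) by [].
    by apply/idP/idP => /set_mem H; apply/mem_set; [rewrite TE|rewrite -TE].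
  rewrite -mulrBr normrM indicE; case: (x \in T); last first.
    by rewrite normr0 mul0r divr_ge0 ?enorm_ge0//; lra.
  by rewrite normr1 mul1r.
have [w xyw wr] := cT _ _ Ox Oy xy TE.
have w0 : ramp r0 r1 (enorm (w - y0)) = 0 by apply: ramp_eq0 => //; lra.
have := segment_enorm _ _ _ xyw; have := enorm_ge0 (x - w); have := enorm_ge0 (w - y).
have := rampL x w; have := rampL y w; rewrite w0 !subr0 => ry rx wy0 xw0 xwy.
have /andP[x0 _] := ramp_itv r0 r1 (enorm (x - y0)).
have /andP[y0' _] := ramp_itv r0 r1 (enorm (y - y0)).
rewrite (ger0_norm x0) in rx; rewrite (ger0_norm y0') in ry.
rewrite !indicE; have [Tx|Tx] := pselect (T x); have [Ty|Ty] := pselect (T y).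
- by exfalso; apply: TE; apply/propext; split.
- rewrite mem_set// memNset// mul1r mul0r subr0 ger0_norm//.
  by apply: le_trans rx _; rewrite ler_pM2r//; lra.
- rewrite memNset// mem_set// mul1r mul0r sub0r normrN ger0_norm//.
  by apply: le_trans ry _; rewrite ler_pM2r// (enormB y w); lra.
- by exfalso; apply: TE; apply/propext; split.
Qed.

(** The set [A] meeting every pair on which the test function changes is left free: it will be a
    ball for the first ramp and a tail of [T] for the iteration. *)
Lemma ramp_capacity : exists2 K : R, 0 < K &
  forall (T A Z : set 'rV[R]_n) y0 (r r0 r1 a c : R),
  r <= r0 -> r0 < r1 -> measurable T -> measurable A -> measurable Z ->
  (leb A <= a%:E)%E -> cut_off_by T y0 r ->
  (forall x y, Omega x -> Omega y -> eball x (bdist Omega x) y ->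
     \1_T x * ramp r0 r1 (enorm (x - y0)) <> \1_T y * ramp r0 r1 (enorm (y - y0)) ->
     A x \/ A y) ->
  Z `<=` Omega -> (forall z, Z z -> T z -> enorm (z - y0) <= r0) ->
  (c%:E <= leb (Omega `&` (T `\` eball y0 r1)))%E -> (c%:E <= leb Z)%E ->
  c <= K * ((r1 - r0) `^ (- (p * delta)) * a) `^ (q / p).
Proof.
have [K K0 HK] := sobolev_poincare_capacity Omega p q delta oOmega bOmega finOmega p1 pq d01 SP.
exists K => // T A Z y0 r r0 r1 a c rr r01 mT mA mZ Aa cT uA ZO ZT cP cZ.
pose u x := \1_T x * ramp r0 r1 (enorm (x - y0)).
have mO : measurable Omega by exact: measurable_open_rV.
apply: (HK u A (Omega `&` (T `\` eball y0 r1)) Z) => //.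
- by rewrite subr_gt0.
- by apply: measurableI => //; apply: measurableD => //; exact: measurable_eball.
- apply: measurable_funM; first exact: measurable_indic.
  apply: (measurableT_comp (measurable_ramp r0 r1)).
  exact: measurable_enormB.
- move=> x; rewrite /u indicE; have := ramp_itv r0 r1 (enorm (x - y0)).
  by case: (x \in T); rewrite ?mul1r ?mul0r// lexx ler01.
- move=> x y Ox Oy xy; split; first exact: cut_off_lipschitz cT rr r01 Ox Oy xy.
  by move=> /eqP; exact: uA.
- move=> x [_ [Tx xr]]; rewrite /u indicE mem_set// mul1r ramp_eq1//.
  by rewrite leNgt; apply/negP.
- move=> z Zz; rewrite /u indicE; have [Tz|Tz] := pselect (T z).
    by rewrite ramp_eq0 ?mulr0//; exact: ZT.
  by rewrite memNset// mul0r.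
Qed.

End ramp_capacity.

(** * Finite measure: bounded inradius, nonempty boundary *)

Section finite_measure.
Context {R : realType} {n : nat} (Omega : set 'rV[R]_n).
Local Notation leb := (lebesgue_rV n).
Hypothesis n_gt0 : (0 < n)%N.
Hypothesis oOmega : open Omega.
Hypothesis finOmega : (leb Omega < +oo)%E.

Lemma lebesgue_rV_open_gt0 (A : set 'rV[R]_n) x : open A -> A x -> (0 < leb A)%E.
Proof.
move=> oA Ax; have [r r0 rA] := open_eballP _ _ oA Ax.
apply: (@lt_le_trans _ _ ((2 * (r / n%:R)) ^+ n)%:E).
  by rewrite lte_fin exprn_gt0// mulr_gt0// divr_gt0// ltr0n.
apply: le_trans (lebesgue_rV_eball_ge x r n_gt0 r0) _.
by apply: le_measure; rewrite ?inE//; [exact: measurable_eball|exact: measurable_open_rV].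
Qed.

Lemma inradius_le : exists2 D : R, 0 < D & forall (x : 'rV[R]_n) r, 0 < r ->
  eball x r `<=` Omega -> r <= D.
Proof.
have mO : measurable Omega by exact: measurable_open_rV.
have n0 : 0 < n%:R :> R by rewrite ltr0n.
pose M := fine (leb Omega).
have MO : leb Omega = M%:E by rewrite fineK// ge0_fin_numE.
(* A bound without n-th roots: for t = r/n either t <= 1, or t <= (2t)^n <= M. *)
exists (n%:R * (1 + M)) => [|x r r0 rO].
  by rewrite mulr_gt0// ltr_pwDl// fine_ge0.
rewrite -ler_pdivrMl// mulrC.
have rM : (2 * (r / n%:R)) ^+ n <= M.
  rewrite -lee_fin -MO; apply: le_trans (lebesgue_rV_eball_ge x r n_gt0 r0) _.
  by apply: le_measure; rewrite ?inE//; exact: measurable_eball.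
have t0 : 0 < r / n%:R by rewrite divr_gt0.
have [t1|t1] := leP (r / n%:R) 1.
  by apply: le_trans t1 _; rewrite lerDl fine_ge0.
have : r / n%:R <= (2 * (r / n%:R)) ^+ n.
  apply: (@le_trans _ _ (2 * (r / n%:R))); first by lra.
  by apply: ler_eXnr => //; lra.
by lra.
Qed.

(** Otherwise [Omega] would be the whole space and contain balls of every radius. This makes [bdist]
    a genuine distance. *)
Lemma boundary_neq0 : Omega !=set0 -> boundary Omega !=set0.
Proof.
move=> [x Ox]; have [D D0 HD] := inradius_le.
have [[y Oy]|HO] := pselect (exists y, ~ Omega y).
  by have [z _ Bz] := segment_boundary _ _ _ Ox Oy; exists z.
suff : D + 1 <= D by lra.
apply: (HD x); first by lra.
by move=> y _; apply: contrapT => Oy; apply: HO; exists y.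
Qed.

End finite_measure.

(** * Extent of a set cut off by a ball *)

Section cut_off_diameter.
Context {R : realType} {n : nat} (Omega : set 'rV[R]_n) (p q delta : R).
Local Notation leb := (lebesgue_rV n).
Hypothesis n_gt0 : (0 < n)%N.
Hypothesis oOmega : open Omega.
Hypothesis Omega0 : Omega !=set0.
Hypothesis finOmega : (leb Omega < +oo)%E.
Hypotheses (p1 : 1 <= p) (pq : p < q) (d01 : 0 < delta < 1).
Hypothesis SP : fractional_sobolev_poincare delta q p 1 Omega.

Let alpha := p * delta.
Let b := q / p.
Let M := fine (leb Omega).
Let bOmega : boundary Omega !=set0.
Proof. exact: boundary_neq0. Qed.
Let mOmega : measurable Omega.
Proof. exact: measurable_open_rV. Qed.
Let ME : leb Omega = M%:E.
Proof. by rewrite fineK// ge0_fin_numE. Qed.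
Let M0 : 0 < M.
Proof.
by have [x Ox] := Omega0; rewrite -lte_fin -ME; exact: lebesgue_rV_open_gt0 Ox.
Qed.
Let alpha0 : 0 < alpha.
Proof. by case/andP: d01 => d0 _; rewrite mulr_gt0//; move: p1; lra. Qed.
Let b1 : 1 < b.
Proof. by have p0 : 0 < p by [move: p1; lra]; rewrite ltr_pdivlMr// mul1r. Qed.

(** With m(s) = |T \ B(y0, s)|, a first ramp bounds m(r1) by a power of d, and Stampacchia's
    iteration makes m vanish at a further distance C m(r1)^be. An open set has no points where its
    measure is 0. *)
Lemma cut_off_diameter_le (C0 c0 : R) : 0 < C0 -> 0 < c0 ->
  exists2 C : R, 0 < C & forall (T : set 'rV[R]_n) y0, open T -> T `<=` Omega -> Omega y0 ->
    let d := bdist Omega y0 in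
    cut_off_by Omega T y0 (C0 * d) ->
    (c0%:E <= leb (Omega `\` (T `\` eball y0 (C0 * d))))%E ->
    forall z, T z -> enorm (z - y0) <=
      C * (d + d `^ ((n%:R - alpha) * b * ((b - 1) / (alpha * b)))).
Proof.
move=> C00 c00.
have [K K0 HK] := ramp_capacity Omega p q delta oOmega bOmega finOmega p1 pq d01 SP.
pose K2 := K * M / c0; have K20 : 0 < K2 by rewrite divr_gt0 ?mulr_gt0.
have [C CC0 HC] := stampacchia K2 alpha b K20 alpha0 b1.
pose be := (b - 1) / (alpha * b).
have be0 : 0 <= be.
  have b0 : 0 <= b by exact: le_trans (ler01) (ltW b1).
  by apply: divr_ge0; [rewrite subr_ge0 ltW|exact: mulr_ge0 (ltW alpha0) b0].
(* The first ramp has width (1 + C0) d, and its ball of radius (1 + 2 C0) d has measure at most (2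
   (1 + 2 C0) d)^n. *)
pose K3 := K2 * ((1 + C0) `^ (- alpha) * (2 * (1 + 2 * C0)) ^+ n) `^ b.
have K30 : 0 < K3.
  have h1 : 0 < 1 + C0 by lra.
  have h2 : 0 < 2 * (1 + 2 * C0) by lra.
  by rewrite mulr_gt0// powR_gt0// mulr_gt0 ?powR_gt0 ?exprn_gt0.
exists (1 + 2 * C0 + C * K3 `^ be).
  by have := powR_gt0 be K30; have := mulr_gt0 CC0 (powR_gt0 be K30); lra.
move=> T y0 oT TO Oy0 d cT c0Z z Tz.
have d0 : 0 < d by exact: bdist_gt0.
have mT : measurable T by exact: measurable_open_rV.
have mTB s : measurable (T `\` eball y0 s).
  by apply: measurableD => //; exact: measurable_eball.
have lTB s : (leb (T `\` eball y0 s) <= M%:E)%E.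
  rewrite -ME; apply: le_measure; rewrite ?inE//.
  by move=> x [/TO].
pose m s := fine (leb (T `\` eball y0 s)).
have mE s : leb (T `\` eball y0 s) = (m s)%:E.
  by rewrite fineK// ge0_fin_numE//; apply: le_lt_trans (lTB s) (ltry _).
have m0 s : 0 <= m s by rewrite fine_ge0.
have mM s : m s <= M by rewrite -lee_fin -mE.
have mni : {homo m : s s' / s <= s' >-> s' <= s}.
  move=> s s' ss'; rewrite -lee_fin -!mE; apply: le_measure; rewrite ?inE//.
  by move=> x [Tx xs']; split => // xs; apply: xs'; apply: lt_le_trans ss'.
have mZ : measurable (Omega `\` (T `\` eball y0 (C0 * d))) by exact: measurableD.
have c0M : c0 <= M.
  rewrite -lee_fin -ME; apply: le_trans c0Z _.
  by apply: le_measure; rewrite ?inE//; move=> x [].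
have mass_le A s s' (a : R) : C0 * d <= s -> s < s' -> measurable A -> (leb A <= a%:E)%E ->
    (forall x y, Omega x -> Omega y -> eball x (bdist Omega x) y ->
     \1_T x * ramp s s' (enorm (x - y0)) <> \1_T y * ramp s s' (enorm (y - y0)) ->
     A x \/ A y) ->
    m s' <= K2 * ((s' - s) `^ (- alpha) * a) `^ b.
  move=> ds ss' mA Aa HA.
  (* The capacity estimate sees only the smaller of two measures. Both the tail and the zero set
     have measure at least m(s') c0 / M, since c0 <= M and m(s') <= M; this is why K2 = K M / c0. *)
  have : m s' * c0 / M <= K * ((s' - s) `^ (- alpha) * a) `^ b.
    apply: (HK T A (Omega `\` (T `\` eball y0 (C0 * d))) y0 (C0 * d)) => //.
    - move=> x [_ nTx] Tx; apply: contrapT => /negP; rewrite -ltNge => xs.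
      by apply: nTx; split => //; rewrite /eball/=; apply/negP; rewrite -leNgt; lra.
    - rewrite setIidr; last by move=> x [/TO].
      by rewrite mE lee_fin -mulrA ler_piMr// ler_pdivrMr ?mul1r.
    - apply: le_trans c0Z; rewrite lee_fin mulrAC ler_piMl ?(ltW c00)//.
      by rewrite ler_pdivrMr// mul1r.
  rewrite ler_pdivrMr// -ler_pdivlMr// /K2; move/le_trans; apply.
  by rewrite le_eqVlt; apply/predU1P; left; ring.
pose r1 := (1 + 2 * C0) * d.
have r10 : C0 * d < r1 by rewrite /r1 ltr_pM2r//; lra.
have mr1 : m r1 <= K3 * d `^ ((n%:R - alpha) * b).
  have r1p : 0 < r1 by rewrite mulr_gt0//; lra.
  have := mass_le (eball y0 r1) (C0 * d) r1 ((2 * r1) ^+ n) (lexx _) r10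
    (measurable_eball _ _) (lebesgue_rV_eball_le _ _ r1p).
  move=> /(_ _)/le_trans; apply.
    move=> x y Ox Oy xy uxy; apply: contrapT => /not_orP[nx ny].
    have {}nx : r1 <= enorm (x - y0) by rewrite leNgt; apply/negP.
    have {}ny : r1 <= enorm (y - y0) by rewrite leNgt; apply/negP.
    have [TE|TE] := pselect (T x = T y).
      apply: uxy; rewrite !ramp_eq1// !mulr1 !indicE.
      suff -> : (y \in T) = (x \in T) by [].
      by apply/idP/idP => /set_mem H; apply/mem_set; [rewrite TE|rewrite -TE].
    (* By the triangle inequality [B x (d x)] does not reach further than
       [d y0 + 2 C0 d y0] once a segment from [x] has met [B y0 (C0 d y0)]. *)
    have [w xyw wd] := cT _ _ Ox Oy xy TE.
    have := bdist_lipschitz Omega bOmega x y0; have := segment_enorm _ _ _ xyw.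
    have := enormBD w x y0; have := enormBD w y y0.
    move: xy ny; rewrite /eball/= (enormB y x) (enormB y w) /r1 -/d; lra.
  have -> : r1 - C0 * d = (1 + C0) * d by rewrite /r1; ring.
  rewrite /K3 -mulrA ler_pM2l// [2 * r1]mulrA exprMn -[d ^+ n]powR_mulrn ?(ltW d0)//.
  have h1 : 0 <= 1 + C0 by lra.
  rewrite [((1 + C0) * d) `^ _]powRM// ?(ltW d0)//.
  rewrite (_ : _ * _ * (_ * _) = ((1 + C0) `^ (- alpha) * (2 * (1 + 2 * C0)) ^+ n) *
     (d `^ (- alpha) * d `^ n%:R)); last by ring.
  have h2 : 0 <= (2 * (1 + 2 * C0)) ^+ n by rewrite exprn_ge0//; lra.
  rewrite -powRDp// powRM; [|exact: mulr_ge0 (powR_ge0 _ _) h2|exact: powR_ge0].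
  by rewrite -powRrM (addrC _ n%:R).
pose D := C * m r1 `^ be.
have D0 : 0 <= D by rewrite mulr_ge0 ?powR_ge0 ?ltW.
have mD : m (r1 + D) = 0.
  (* The test function vanishes off the tail of [T] beyond [s], so that tail serves as [A] and the
     estimate becomes a recursion in [m]. *)
  apply: HC => // s s' r1s ss'; apply: (mass_le (T `\` eball y0 s)) => //; first lra.
    by rewrite mE.
  move=> x y Ox Oy xy uxy; apply: contrapT => /not_orP[nx ny]; apply: uxy.
  suff H w : ~ (T `\` eball y0 s) w -> \1_T w * ramp s s' (enorm (w - y0)) = 0.
    by rewrite !H.
  move=> nw; rewrite indicE; have [Tw|Tw] := pselect (T w); last by rewrite memNset ?mul0r.
  rewrite ramp_eq0 ?mulr0// leNgt; apply/negP => sw; apply: nw; split => //.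
  by rewrite /eball/=; apply/negP; rewrite -leNgt ltW.
have zle : enorm (z - y0) <= r1 + D.
  rewrite leNgt; apply/negP => zD.
  pose U := T `&` ~` [set x | enorm (x - y0) <= r1 + D].
  have oU : open U by apply: openI => //; exact/closed_openC/closed_enormB_le.
  have Uz : U z by split => //=; apply/negP; rewrite -ltNge.
  have := lebesgue_rV_open_gt0 n_gt0 U z oU Uz; apply/negP.
  rewrite -leNgt (_ : 0%E = (m (r1 + D))%:E); last by rewrite mD.
  rewrite -mE.
  apply: le_measure; rewrite ?inE//; first exact: measurable_open_rV.
  move=> x [Tx xD]; split => // xr; apply: xD; exact: ltW.
apply: le_trans zle _; rewrite mulrDr.
have DE : D <= C * K3 `^ be * d `^ ((n%:R - alpha) * b * be).
  rewrite /D -mulrA ler_pM2l// (powRrM d) -powRM ?powR_ge0 ?(ltW K30)//.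
  by apply: ge0_ler_powR => //; rewrite nnegrE// mulr_ge0 ?powR_ge0 ?(ltW K30).
move: DE; rewrite -/be /r1; set X := d `^ _; set W := C * _ => DE.
have W0 : 0 <= W by rewrite mulr_ge0 ?powR_ge0// ltW.
have := mulr_ge0 W0 (ltW d0); have := mulr_ge0 (ltW C00) (powR_ge0 d _ : 0 <= X).
have : 0 <= X by exact: powR_ge0.
by move: (D) DE => D' DE; lra.
Qed.

End cut_off_diameter.

(** * Upper bound on the Sobolev exponent *)

Section exponent.
Context {R : realType} {n : nat} (Omega : set 'rV[R]_n) (p q delta : R).
Local Notation leb := (lebesgue_rV n).
Hypothesis n_gt0 : (0 < n)%N.
Hypothesis oOmega : open Omega.
Hypothesis Omega0 : Omega !=set0.
Hypothesis finOmega : (leb Omega < +oo)%E.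
Hypotheses (p1 : 1 <= p) (pq : p < q) (d01 : 0 < delta < 1).
Hypothesis SP : fractional_sobolev_poincare delta q p 1 Omega.

(* Shrinking bumps: with [T] the whole space the cut-off vanishes near [x0] and
   is 1 away from it. *)
Lemma sobolev_exponent_le : (n%:R - p * delta) * (q / p) <= n%:R.
Proof.
have bOmega : boundary Omega !=set0 by exact: boundary_neq0.
have mOmega : measurable Omega by exact: measurable_open_rV.
have [K K0 HK] := ramp_capacity Omega p q delta oOmega bOmega finOmega p1 pq d01 SP.
have [x0 Ox0] := Omega0.
set d := bdist Omega x0.
have d0 : 0 < d by exact: bdist_gt0.
have dO : eball x0 d `<=` Omega by exact: eball_bdist_sub.
have nR : 0 < n%:R :> R by rewrite ltr0n.
have n1 : 1 <= n%:R :> R by rewrite ler1n.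
set e := (n%:R - p * delta) * (q / p).
rewrite leNgt; apply/negP => ne.
pose K1 := K * (4 ^+ n) `^ (q / p).
have K10 : 0 < K1 by rewrite mulr_gt0// powR_gt0// exprn_gt0.
pose k := (2 / n%:R) ^+ n : R.
have k0 : 0 < k by rewrite exprn_gt0// divr_gt0.
(* The ramp between h and 2h about [x0], with A = B(x0, 2h), compares h^n with h^e. For e > n this
   fails as h tends to 0. *)
have bump h : 0 < h -> 4 * h <= d / n%:R -> k <= K1 * h `^ (e - n%:R).
  move=> h0 hd.
  have h2 : 0 < 2 * h by rewrite mulr_gt0.
  have hd' : h <= d.
    have : d / n%:R <= d by rewrite ler_pdivrMr// ler_peMr// ltW.
    lra.
  have setTcut : cut_off_by Omega setT x0 h by move=> x y _ _ _; case.
  have ball_le : (leb (eball x0 (2 * h)) <= ((2 * (2 * h)) ^+ n)%:E)%E.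
    exact: lebesgue_rV_eball_le.
  have mball r : measurable (eball x0 r) by exact: measurable_eball.
  (* Ensures that [Omega] minus B(x0, 2h) still has measure at least (2h/n)^n, the lower bound used
     for B(x0, h). *)
  have sum_le : (2 * (h / n%:R)) ^+ n + (2 * (2 * h)) ^+ n <= (2 * (d / n%:R)) ^+ n.
    have hn : h / n%:R <= h by rewrite ler_pdivrMr// ler_peMr// ltW.
    have t0 : 0 <= d / n%:R by rewrite divr_ge0// ltW.
    have hn0 : 0 <= h / n%:R by rewrite divr_ge0// ltW.
    apply: (@le_trans _ _ ((d / n%:R) ^+ n + (d / n%:R) ^+ n)).
      by apply: lerD; apply: lerXn2r; rewrite ?nnegrE//; lra.
    rewrite [leRHS]exprMn -mulr2n -[leLHS]mulr_natl.
    by apply: ler_wpM2r; [exact: exprn_ge0|apply: ler_eXnr => //; lra].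
  have := HK setT (eball x0 (2 * h)) (eball x0 h) x0 h h (2 * h)
    ((2 * (2 * h)) ^+ n) ((2 * (h / n%:R)) ^+ n) (lexx _).
  have -> : 2 * h - h = h by ring.
  move=> /(_ _ _ _ _ ball_le setTcut) HKh.
  have : (2 * (h / n%:R)) ^+ n <=
      K * (h `^ (- (p * delta)) * (2 * (2 * h)) ^+ n) `^ (q / p).
    apply: HKh => //.
    - by rewrite ltr_pMl//; lra.
    - move=> x y _ _ _ uxy; apply: contrapT => /not_orP[nx ny]; apply: uxy.
      rewrite !indicE !in_setT !ramp_eq1//; first by rewrite ltr_pMl//; lra.
      + by rewrite leNgt; apply/negP.
      + by rewrite ltr_pMl//; lra.
      + by rewrite leNgt; apply/negP.
    - by move=> x xh; apply: dO; apply: lt_le_trans xh hd'.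
    - by move=> x xh _; exact: ltW.
    - set P := Omega `&` _.
      have mP : measurable P by apply: measurableI => //; exact: measurableD.
      have Pfin : leb P \is a fin_num.
        rewrite ge0_fin_numE//; apply: le_lt_trans finOmega.
        by apply: le_measure; rewrite ?inE//; move=> x [].
      have : (leb Omega <= leb P + leb (eball x0 (2 * h)))%E.
        apply: le_trans (measureU2 _ _ _) => //; apply: le_measure; rewrite ?inE//.
          exact: measurableU.
        by move=> x Ox; have [xh|xh] := pselect (eball x0 (2 * h) x); [right|left].
      have : (((2 * (d / n%:R)) ^+ n)%:E <= leb Omega)%E.
        apply: le_trans (lebesgue_rV_eball_ge x0 d n_gt0 d0) _.
        by apply: le_measure; rewrite ?inE.
      move=> /le_trans /[apply] /le_trans /(_ (leeD2l _ ball_le)).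
      rewrite -(fineK Pfin) -EFinD !lee_fin; lra.
    - exact: lebesgue_rV_eball_ge.
  have -> : 2 * (h / n%:R) = 2 / n%:R * h by ring.
  have -> : 2 * (2 * h) = 4 * h by ring.
  rewrite [(2 / n%:R * h) ^+ n]exprMn [(4 * h) ^+ n]exprMn.
  rewrite [_ * (4 ^+ n * _)]mulrCA powRM ?mulr_ge0 ?powR_ge0 ?exprn_ge0 ?(ltW h0)//.
  rewrite -(powR_mulrn n (ltW h0)) -powRDp// -powRrM (addrC _ n%:R) -/e mulrA -/K1.
  rewrite powRDp// powRN -/k mulrA => kh; by rewrite ler_pdivlMr ?powR_gt0.
(* Small enough that K1 h^(e-n) <= k/2, contradicting [bump]. *)
pose h := Num.min (d / n%:R / 4) ((k / (2 * K1)) `^ (e - n%:R)^-1).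
have en0 : 0 < e - n%:R by rewrite subr_gt0.
have hh : 0 < (k / (2 * K1)) `^ (e - n%:R)^-1.
  by rewrite powR_gt0// divr_gt0// mulr_gt0.
have h0 : 0 < h by rewrite lt_min !divr_gt0.
have : k <= K1 * h `^ (e - n%:R).
  apply: bump => //; rewrite mulrC -ler_pdivlMr//; rewrite /h ge_min lexx//.
have : h `^ (e - n%:R) <= k / (2 * K1).
  have -> : k / (2 * K1) = ((k / (2 * K1)) `^ (e - n%:R)^-1) `^ (e - n%:R).
    by rewrite -powRrM mulVf ?gt_eqF// powRr1// divr_ge0 ?mulr_ge0 ?ltW.
  apply: ge0_ler_powR; rewrite ?nnegrE ?powR_ge0//; [exact: ltW..|].
  by rewrite /h ge_min lexx orbT.
rewrite -(ler_pM2l K10) => /[swap] /le_trans /[apply].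
rewrite (_ : K1 * (k / (2 * K1)) = k / 2); first by lra.
by field; rewrite gt_eqF.
Qed.

End exponent.

(** * Components of the domain minus a sphere *)

Section component.
Context {R : realType} {n : nat} (Omega : set 'rV[R]_n).
Local Notation leb := (lebesgue_rV n).
Hypothesis n_gt0 : (0 < n)%N.
Hypothesis oOmega : open Omega.
Hypothesis bOmega : boundary Omega !=set0.

(** A segment that misses the closed ball misses the sphere; for a pair seen by the energy it also
    stays in [Omega], so its endpoints share a component. *)
Lemma cut_off_by_component y0 r z :
  cut_off_by Omega (connected_component (Omega `\` boundary (eball y0 r)) z) y0 r.
Proof.
move=> x y Ox Oy xy TE; apply: contrapT => nw; apply: TE.
have sO w : segment x y w -> (Omega `\` boundary (eball y0 r)) w.
  move=> xyw; split; first exact: segment_bdist_sub xyw.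
  by move=> Bw; apply: nw; exists w => //; exact: boundary_eball_le.
apply/propext; split => zx; apply: connected_component_segment zx _ => // w.
by rewrite segmentC; exact: sO.
Qed.

(** If d(y0) is at least k d(x0), a ball about [y0] of fixed radius lies in both [B] and [Omega].
    Otherwise [B] is small and far from [x0], so a fixed ball about [x0] avoids the sphere and hence
    [T], which does not contain [x0]. *)
Lemma off_component_measure_ge x0 (C0 : R) : Omega x0 -> 0 < C0 ->
  exists2 c : R, 0 < c & forall y0 z, Omega y0 ->
    let B := eball y0 (C0 * bdist Omega y0) in
    let T := connected_component (Omega `\` boundary B) z in
    ~ T x0 -> (c%:E <= leb (Omega `\` (T `\` B)))%E.
Proof.
move=> Ox0 C00; set d0 := bdist Omega x0.
have d00 : 0 < d0 by exact: bdist_gt0.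
(* For d(y0) < k d(x0) this gives C0 d(y0) <= d(x0)/4 and d(y0) <= d(x0)/2, so points within d(x0)/4
   of [x0] lie outside the closed ball. *)
pose k := Num.min 2^-1 (4 * C0)^-1.
have k0 : 0 < k by rewrite lt_min !invr_gt0 ltr0n/= mulr_gt0.
have k2 : k <= 2^-1 by rewrite ge_min lexx.
have k4 : C0 * k <= 4^-1.
  by rewrite mulrC -ler_pdivlMr// -invfM ge_min lexx orbT.
pose m := Num.min C0 1; have m0 : 0 < m by rewrite lt_min C00 ltr01.
pose r := Num.min (m * (k * d0)) (d0 / 4).
have r0 : 0 < r by rewrite lt_min mulr_gt0 ?divr_gt0// mulr_gt0.
exists ((2 * (r / n%:R)) ^+ n) => [|y0 z Oy0 B T Tx0].
  by rewrite exprn_gt0// mulr_gt0// divr_gt0// ltr0n.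
set d := bdist Omega y0 in B T Tx0 *.
have d'0 : 0 < d by exact: bdist_gt0.
have oT : open T.
  apply: open_connected_component; apply: openI => //.
  exact/closed_openC/closed_boundary.
suff [x xrZ] : exists x, eball x r `<=` Omega `\` (T `\` B).
  apply: le_trans (lebesgue_rV_eball_ge x r n_gt0 r0) _.
  apply: le_measure; rewrite ?inE//; first exact: measurable_eball.
  apply: measurableD; first exact: measurable_open_rV.
  by apply: measurableD; [exact: measurable_open_rV|exact: measurable_eball].
have [dk|dk] := leP (k * d0) d.
  have rmd : r <= m * d.
    rewrite ge_min; apply/orP; left; rewrite ler_pM2l//.
  exists y0 => w wr; split.
    apply: (eball_bdist_sub _ _ Oy0); apply: lt_le_trans wr _.
    by apply: le_trans rmd _; rewrite ler_piMl ?(ltW d'0)// /m ge_min lexx orbT.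
  move=> [_]; apply; apply: lt_le_trans wr _; apply: le_trans rmd _.
  by rewrite ler_pM2r// /m ge_min lexx.
have rd : r <= d0 / 4 by rewrite ge_min lexx orbT.
have rO : eball x0 r `<=` Omega.
  apply: subset_trans (eball_bdist_sub _ _ Ox0) => w wr.
  by apply: lt_le_trans wr _; rewrite -/d0; lra.
exists x0 => w wr; split; first exact: rO.
move=> [Tw _]; apply: Tx0; apply: connected_component_segment Tw _ => v wv.
have vr : eball x0 r v.
  by move: wv; rewrite segmentC; apply: segment_sub_eball; rewrite enormB.
split; first exact: rO.
move=> /boundary_eball_le; apply/negP; rewrite -ltNge.
have := bdist_lipschitz Omega bOmega x0 y0; rewrite -/d0 -/d.
have := enormBD v x0 y0; rewrite (enormB x0 v).
have : C0 * d <= d0 / 4.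
  apply: (@le_trans _ _ (C0 * (k * d0))); first by rewrite ler_pM2l// ltW.
  by rewrite mulrA mulrC ler_pM2l.
have : k * d0 <= 2^-1 * d0 by rewrite ler_pM2r.
by move: vr; rewrite /eball/=; lra.
Qed.

End component.

(** * From the separation property to the diameter bound *)

Theorem theorem0p6 (R : realType) (n : nat) (delta p q : R)
    (Omega : set 'rV[R]_n) (x0 : 'rV[R]_n)
    (n_ge2 : (2 <= n)%N)
    (delta_gt0 : 0 < delta) (delta_lt1 : delta < 1)
    (domOmega : domain Omega)
    (finOmega : (lebesgue_rV n Omega < +oo)%E)
    (Omega_x0 : Omega x0)
    (sepOmega : separation_property Omega x0)
    (p_ge1 : 1 <= p) (p_lt : p < n%:R / delta) (p_lt_q : p < q)
    (spOmega : fractional_sobolev_poincare delta q p 1 Omega) :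
  let phi (r : R) :=
    r `^ ((n%:R - p * delta) * q / (p * delta) * (p^-1 - q^-1)) in
  exists C : R, forall x, Omega x ->
    exists2 gamma, curve_from_to Omega x x0 gamma &
    forall t : R, t \in `[0, 1] ->
      (ediam (gamma @` `[0, t])%R <= (C * phi (bdist Omega (gamma t)))%:E)%E.
Proof.
move=> phi; have [oO _ O0] := domOmega.
have n_gt0 : (0 < n)%N by exact: ltnW.
have d01 : 0 < delta < 1 by rewrite delta_gt0.
have p0 : 0 < p by lra.
have q0 : 0 < q by lra.
have bO : boundary Omega !=set0 by exact: boundary_neq0.
have [D D0 HD] := inradius_le Omega n_gt0 oO finOmega.
have expo := sobolev_exponent_le Omega p q delta n_gt0 oO O0 finOmega p_ge1 p_lt_q d01 spOmega.
have [C0 C00 sep] := sepOmega.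
have [c c0 off_ge] := off_component_measure_ge Omega n_gt0 oO bO x0 C0 Omega_x0 C00.
have [C1 C10 diam_le] := cut_off_diameter_le Omega p q delta n_gt0 oO O0 finOmega
  p_ge1 p_lt_q d01 spOmega C0 c C00 c0.
set s := (n%:R - p * delta) * (q / p) * ((q / p - 1) / (p * delta * (q / p))) in diam_le.
have phiE r : phi r = r `^ s.
  congr (_ `^ _); rewrite /s; field.
  by rewrite !gt_eqF.
(* Rewritten as ((n - p delta) q/p - (n - p delta)) / (p delta), this is exactly the exponent bound
   [expo]. *)
have s1 : s <= 1.
  rewrite (_ : s = ((n%:R - p * delta) * (q / p) - (n%:R - p * delta)) / (p * delta)).
    by rewrite ler_pdivrMr ?mulr_gt0//; lra.
  by rewrite /s; field; rewrite !gt_eqF.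
(* As d is at most the inradius bound D and s <= 1, d = d^(1-s) d^s <= D^(1-s) phi(d). *)
pose C2 := D `^ (1 - s).
have C20 : 0 < C2 by rewrite powR_gt0.
have le_phi y : Omega y -> bdist Omega y <= C2 * phi (bdist Omega y).
  move=> Oy; have d0 : 0 < bdist Omega y by exact: bdist_gt0.
  have dE : bdist Omega y = bdist Omega y `^ (1 - s) * bdist Omega y `^ s.
    by rewrite -powRDp// subrK powRr1// ltW.
  rewrite phiE [leLHS]dE; apply: ler_wpM2r; first exact: powR_ge0.
  apply: ge0_ler_powR.
  - by rewrite subr_ge0.
  - by rewrite nnegrE ltW.
  - by rewrite nnegrE ltW.
  - by apply: (HD y) => //; exact: eball_bdist_sub.
(* The first summand serves points in a separated component, the second those within C0 d of
   gamma(t). The factor 2 below passes from the distance to gamma(t) to the diameter. *)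
pose C3 := C1 * (C2 + 1) + C0 * C2.
exists (2 * C3) => x Ox; have [gamma cg gsep] := sep x Ox.
exists gamma => // t t01; have [_ gO _ _] := cg.
set y0 := gamma t; set d := bdist Omega y0.
have Oy0 : Omega y0 by exact: gO.
have d0 : 0 < d by exact: bdist_gt0.
have dphi := le_phi _ Oy0; rewrite -/d in dphi.
have phi0 : 0 <= phi d by exact: powR_ge0.
have in_ball z : enorm (z - y0) <= C0 * d -> enorm (z - y0) <= C3 * phi d.
  move=> /le_trans; apply; rewrite /C3 mulrDl -[leLHS]add0r; apply: lerD.
    by rewrite mulr_ge0// mulr_ge0 ?addr_ge0 ?ltW.
  by rewrite -mulrA ler_pM2l.
have gt_le z : (gamma @` `[0, t]) z -> enorm (z - y0) <= C3 * phi d.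
  move=> gz; have [zB|zB] := pselect (eball y0 (C0 * d) z).
    by apply: in_ball; exact: ltW.
  have Oz : Omega z.
    move: gz => [u]; rewrite /= in_itv/= => /andP[u0 ut] <-; apply: gO.
    by move: t01; rewrite !in_itv/= u0 => /andP[_ t1]; exact: le_trans t1.
  have [gB|gsep'] := gsep t t01; first by case: zB; exact: gB.
  (* Points on the sphere lie in no component, so separation says nothing about them; they are
     within C0 d of gamma(t) anyway. *)
  have [Bz|Bz] := pselect (boundary (eball y0 (C0 * d)) z).
    by apply: in_ball; exact: boundary_eball_le.
  pose T := connected_component (Omega `\` boundary (eball y0 (C0 * d))) z.
  have Tz : T z by exact: connected_component_refl.
  have oT : open T.
    apply: open_connected_component; apply: openI => //.
    exact/closed_openC/closed_boundary.
  have TO : T `<=` Omega by move=> w /connected_component_sub[].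
  have nTx0 : ~ T x0 by apply: gsep'.
  have := diam_le T y0 oT TO Oy0 (cut_off_by_component _ _ _ _) (off_ge y0 z Oy0 nTx0) z Tz.
  move=> /le_trans; apply; rewrite -/d -phiE /C3 mulrDl -mulrA [leRHS]addrC.
  rewrite -[leLHS]add0r; apply: lerD.
    by rewrite !mulr_ge0// ltW.
  by rewrite ler_pM2l// mulrDl mul1r lerD2r.
apply: ge_ereal_sup => _ [[z w] [/= gz gw] <-]; rewrite lee_fin.
apply: le_trans (enormBD y0 _ _) _; rewrite (enormB y0 w).
by have := gt_le _ gz; have := gt_le _ gw; lra.
Qed.
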